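(* Let $\Phi$ be a stationary point process in $\mathbb{R}^d$ of unit intensity, let $k\ge 1$, and let $\Gamma$ be a connected graph on $k$ vertices which is a feasible subgraph of $\Phi$. Let $\rho^{(k)}$ be almost everywhere continuous. Assume that $\rho^{(k)}(0,\ldots,0)=0$ and that there exist functions $f^k:\mathbb{R}_+\to\mathbb{R}_+$ and $g^k_\rho:(B_0(k))^k\to\mathbb{R}_+$ such that $$\rho^{(k)}(r\mathbf{y})=\Theta(f^k(r))\quad\text{and}\quad \lim_{r\to0}\frac{\rho^{(k)}(r\mathbf{y})}{f^k(r)}=g^k_\rho(\mathbf{y})$$ for all $\mathbf{y}$ of the form $\mathbf{y}=(0,y_2,\ldots,y_k)$. Further assume that $f^{k+1}=O(f^k)$ as $r\to0$ (where $f^{k+1}$ is the corresponding function for $\rho^{(k+1)}$) and that $g^k_\rho$ is almost everywhere continuous. Let $r_n\to0$. Then $$\lim_{n\to\infty}\frac{\mathbb{E}\{G_n(\Phi,\Gamma)\}}{n r_n^{d(k-1)}f^k(r_n)}=\lim_{n\to\infty}\frac{\mathbb{E}\{J_n(\Phi,\Gamma)\}}{n r_n^{d(k-1)}f^k(r_n)}=\mu_0(\Phi,\Gamma),$$ where $\mu_0(\Phi,\Gamma):=1$ if $k=1$, and for $k\ge2$, with $\mathbf{y}=(0,y_2,\ldots,y_k)$ and $d\mathbf{y}=dy_2\cdots dy_k$, $$\mu_0(\Phi,\Gamma):=\frac1{k!}\int_{\mathbb{R}^{d(k-1)}}h_\Gamma(\mathbf{y})\,g^k_\rho(\mathbf{y})\,d\mathbf{y}.$$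 If instead $\rho^{(k)}(0,\ldots,0)>0$, then the same result holds with $f^k\equiv1$ and $g^k_\rho\equiv\rho^{(k)}(0,\ldots,0)$.
   Context: A point process $\Phi$ in $\mathbb{R}^d$ is a random locally finite counting measure, identified with its random set of points; $\Phi(B)$ is the number of points in $B$. $\Phi^{(k)}$ is the set of ordered $k$-tuples of pairwise distinct points of $\Phi$; $\alpha^{(k)}$ is its intensity measure, $\alpha^{(k)}(A)=\mathbb{E}\{\#(\Phi^{(k)}\cap A)\}$, and the $k$th joint intensity $\rho^{(k)}$ is the density of $\alpha^{(k)}$ with respect to Lebesgue measure on $(\mathbb{R}^d)^k$. Standing assumptions: point processes are simple and all joint intensities exist. Stationary means the law is invariant under translations; unit intensity means $\alpha^{(1)}$ is Lebesgue measure, so $\rho^{(1)}\equiv1$ and $f^1\equiv1$. $B_x(r)$ is the ball of radius $r$ centred at $x$; for $\mathbf{x}=(x_1,\ldots,x_k)$, $B_{\mathbf{x}}(r)=\bigcup_i B_{x_i}(r)$. $W_n=[-n^{1/d}/2,n^{1/d}/2]^d$ and $\Phi_n=\Phi\cap W_n$. For a point set $P$ and $r>0$, the geometric graph $G(P,r)$ has vertex set $P$ and an edge between distinct points at distance $\le r$. For a graph $\Gamma$ on $k$ vertices, $h_\Gamma(\mathbf{x},r)=\mathbf{1}[G(\{x_1,\ldots,x_k\},r)\simeq\Gamma]$ (graph isomorphism), $h_{\Gamma,n}(\mathbf{x})=h_\Gamma(\mathbf{x},r_n)$ and $h_\Gamma(\mathbf{x})=h_\Gamma(\mathbf{x},1)$.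 A connected $\Gamma$ on $k$ vertices is a feasible subgraph of $\Phi$ if $\int_{(\mathbb{R}^d)^k}h_\Gamma(\mathbf{x})\rho^{(k)}(\mathbf{x})\,d\mathbf{x}>0$. The radii $r_n>0$ are a given sequence, and $$G_n(\Phi,\Gamma)=\frac1{k!}\sum_{X\in\Phi_n^{(k)}}h_{\Gamma,n}(X),\qquad J_n(\Phi,\Gamma)=\frac1{k!}\sum_{X\in\Phi_n^{(k)}}h_{\Gamma,n}(X)\mathbf{1}[\Phi_n(B_X(r_n))=k].$$
   Formalization: The joint intensities are taken in translation-invariant versions, the upper constant in Θ(f^k) and Θ(f^{k+1}) is uniform in y, and when ρ^(k)(0,…,0)>0 it is also assumed that ρ^(k) is continuous at the origin and that f^{k+1}=O(1). *)

(* Defs.v *)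
From HB Require Import structures.
From mathcomp Require Import all_boot all_order all_algebra.
From mathcomp Require Import all_classical all_reals all_analysis.

Set Implicit Arguments.
Unset Strict Implicit.
Unset Printing Implicit Defensive.

Import Order.TTheory GRing.Theory Num.Theory.
Import numFieldNormedType.Exports.

Local Open Scope classical_set_scope.
Local Open Scope ring_scope.

(* The point space R^d is 'rV[R]_d and a k-tuple (x_1, ..., x_k) of points is  *)
(* the k x d matrix whose rows are the x_i. The library topology of matrices   *)
(* is the product topology, i.e. the Euclidean one; distances between points   *)
(* are measured with enorm below, since the library norm is the sup norm.      *)

(* The library proves this too, but the canonical sigma-finite structure on    *)
(* m1 \x m2 is shadowed there by the one for subprobabilities.                 *)
Lemma product_sigma_finite d1 d2 (T1 : measurableType d1)
    (T2 : measurableType d2) (R : realType)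
    (m1 : {sigma_finite_measure set T1 -> \bar R})
    (m2 : {sigma_finite_measure set T2 -> \bar R}) :
  sigma_finite [set: T1 * T2] (m1 \x m2)%E.
Proof.
have /sigma_finiteP[F [TF ndF Foo]] := sigma_finiteT m1.
have /sigma_finiteP[G [TG ndG Goo]] := sigma_finiteT m2.
exists (fun n => F n `*` G n).
  rewrite -setXTT TF TG predeqE => -[x y]; split.
    move=> [/= [n _ Fnx] [k _ Gky]]; exists (maxn n k) => //; split.
    - by move: x Fnx; exact/subsetPset/ndF/leq_maxl.
    - by move: y Gky; exact/subsetPset/ndG/leq_maxr.
  by move=> [n _ []/= ? ?]; split; exists n.
move=> k; have [? ?] := Foo k; have [? ?] := Goo k.
split; first exact: measurableX.
by rewrite product_measure1E// lte_mul_pinfty// ge0_fin_numE.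
Qed.

Section pushforward_sigma_finite.
Context d1 d2 (T1 : measurableType d1) (T2 : measurableType d2) (R : realType).
Variable mu : {measure set T1 -> \bar R}.
Variables (f : T1 -> T2) (g : T2 -> T1).
Hypotheses (mf : measurable_fun [set: T1] f) (mg : measurable_fun [set: T2] g).
Hypothesis fK : cancel f g.

Lemma pushforward_semi_sigma_additive :
  semi_sigma_additive (pushforward mu f).
Proof.
have mpre (A : set T2) : measurable A -> measurable (f @^-1` A).
  by move=> mA; rewrite -[X in measurable X]setTI; exact: mf.
move=> F mF tF mUF; rewrite /pushforward preimage_bigcup.
apply: measure_semi_sigma_additive; first by move=> i; exact: mpre.
- apply/trivIsetP => i j _ _ ij; rewrite -preimage_setI.
  by move/trivIsetP : tF => /(_ _ _ _ _ ij) ->//; rewrite preimage_set0.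
- by rewrite -preimage_bigcup; exact: mpre.
Qed.

Lemma pushforward_sigma_finite :
  sigma_finite setT mu -> sigma_finite setT (pushforward mu f).
Proof.
move=> [F FT Foo].
exists (fun i => g @^-1` F i); first by rewrite -preimage_bigcup -FT.
move=> i; have [mFi Fioo] := Foo i; split.
  by rewrite -[X in measurable X]setTI; exact: mg.
by rewrite /pushforward -comp_preimage (_ : g \o f = id)//; exact/funext.
Qed.

End pushforward_sigma_finite.

Section power_measure.
Context d (T : measurableType d) (R : realType).
Variable mu : {sigma_finite_measure set T -> \bar R}.

Section cons_measure.
Variable n : nat.

Definition cons_pair (p : T * n.-tuple T) : n.+1.-tuple T :=
  [tuple of p.1 :: p.2].

Let uncons (t : n.+1.-tuple T) : T * n.-tuple T :=
  (thead t, [tuple of behead t]).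

Let measurable_cons_pair : measurable_fun [set: _] cons_pair.
Proof. exact: measurable_cons. Qed.

Let measurable_uncons : measurable_fun [set: _] uncons.
Proof.
apply: measurable_fun_pair; first exact: measurable_tnth.
exact: measurable_behead.
Qed.

Let cons_pairK : cancel cons_pair uncons.
Proof. by move=> [x t]; congr pair; exact/val_inj. Qed.

Variable nu : {sigma_finite_measure set (n.-tuple T) -> \bar R}.

Definition cons_measure : set (n.+1.-tuple T) -> \bar R :=
  pushforward (mu \x nu)%E cons_pair.

Let cons_measure0 : cons_measure set0 = 0%E.
Proof. by rewrite /cons_measure /pushforward preimage_set0 measure0. Qed.

Let cons_measure_ge0 A : (0 <= cons_measure A)%E.
Proof. by rewrite /cons_measure /pushforward measure_ge0. Qed.

Let cons_measure_sigma_additive : semi_sigma_additive cons_measure.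
Proof.
exact: (@pushforward_semi_sigma_additive _ _ _ _ _ (mu \x nu)%E _
  measurable_cons_pair).
Qed.

HB.instance Definition _ := isMeasure.Build _ _ _ cons_measure
  cons_measure0 cons_measure_ge0 cons_measure_sigma_additive.

Let cons_measure_sigma_finite : sigma_finite setT cons_measure.
Proof.
apply: (@pushforward_sigma_finite _ _ _ _ _ (mu \x nu)%E _ _
  measurable_uncons cons_pairK).
exact: product_sigma_finite.
Qed.

HB.instance Definition _ :=
  Measure_isSigmaFinite.Build _ _ _ cons_measure cons_measure_sigma_finite.

End cons_measure.

(* The product measure of n copies of mu. *)
Fixpoint power_measure n : {sigma_finite_measure set (n.-tuple T) -> \bar R} :=
  if n is n'.+1 then cons_measure (power_measure n') else \d_[tuple].

Lemma power_measure_box n (A : 'I_n -> set T) :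
  (forall i, measurable (A i)) ->
  power_measure n [set t | forall i, A i (tnth t i)] =
  (\prod_(i < n) mu (A i))%E.
Proof.
elim: n A => [|n IHn] A mA.
  by rewrite big_ord0 /= diracE mem_set//= => -[].
rewrite big_ord_recl -IHn// -product_measure1E//; last first.
  rewrite (_ : [set _ | _] =
      \bigcap_(i in [set: 'I_n]) ((@tnth _ T ^~ i) @^-1` A (lift ord0 i))).
    apply: fin_bigcap_measurable => // i _.
    by rewrite -[X in measurable X]setTI; exact: measurable_tnth.
  by apply/seteqP; split => t At i => [_|]; exact: At.
congr product_measure1; apply/seteqP; split => [[x t] At|[x t] [Ax At] i] /=.
  by split => [|i]; [have := At ord0|have := At (lift ord0 i); rewrite tnthS].
by case: (unliftP ord0 i) => [j|] ->; rewrite ?tnthS ?tnth0//; exact: At.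
Qed.

End power_measure.

Section matrix_measurable.
Context {R : realType} {m n : nat}.

Definition mx_cylinder : set (set 'M[R]_(m, n)) :=
  [set A | exists i j (B : set R),
    measurable B /\ A = [set X : 'M[R]_(m, n) | B (X i j)]].

HB.instance Definition _ := @isMeasurable.Build (sigma_display mx_cylinder)
  'M[R]_(m, n) <<s mx_cylinder >> (@sigma_algebra0 _ setT mx_cylinder)
  (@sigma_algebraC _ mx_cylinder) (@sigma_algebra_bigcup _ setT mx_cylinder).

Lemma measurable_mx_entry (i : 'I_m) (j : 'I_n) :
  measurable_fun [set: 'M[R]_(m, n)] (fun X => X i j).
Proof.
move=> _ B mB; rewrite setTI; apply: sub_sigma_algebra.
by exists i, j, B.
Qed.

Let mx_of_tuple (t : (m * n).-tuple (measurableTypeR R)) : 'M[R]_(m, n) :=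
  \matrix_(i, j) tnth t (mxvec_index i j).

Let tuple_of_mx (X : 'M[R]_(m, n)) :
    (m * n).-tuple (measurableTypeR R) :=
  [tuple mxvec X 0 k | k < (m * n)%N].

Let mx_of_tupleK : cancel mx_of_tuple tuple_of_mx.
Proof.
move=> t; apply: eq_from_tnth => k; rewrite tnth_mktuple.
by case/mxvec_indexP: k => i j; rewrite mxvecE mxE.
Qed.

Let measurable_mx_of_tuple : measurable_fun setT mx_of_tuple.
Proof.
apply: (@measurability _ _ _ _ _ _ mx_cylinder) => //.
move=> _ [_ [i [j [B [mB ->]]]] <-]; rewrite setTI.
rewrite [X in measurable X](_ : _ = (@tnth _ (measurableTypeR R) ^~ (mxvec_index i j)) @^-1` B).
  by rewrite -[X in measurable X]setTI; exact: measurable_tnth.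
by apply/seteqP; split => t /=; rewrite mxE.
Qed.

Let measurable_tuple_of_mx : measurable_fun setT tuple_of_mx.
Proof.
apply/measurable_fun_tnthP => k; case/mxvec_indexP: k => i j.
rewrite (_ : _ \o _ = fun X : 'M[R]_(m, n) => X i j).
  exact: measurable_mx_entry.
by apply/funext => X /=; rewrite tnth_mktuple mxvecE.
Qed.

Let prod_lebesgue := power_measure (@lebesgue_measure R) (m * n).

Definition lebesgue_mx : set 'M[R]_(m, n) -> \bar R :=
  pushforward prod_lebesgue mx_of_tuple.

Let lebesgue_mx0 : lebesgue_mx set0 = 0%E.
Proof. by rewrite /lebesgue_mx /pushforward preimage_set0 measure0. Qed.

Let lebesgue_mx_ge0 A : (0 <= lebesgue_mx A)%E.
Proof. by rewrite /lebesgue_mx /pushforward measure_ge0. Qed.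

Let lebesgue_mx_sigma_additive : semi_sigma_additive lebesgue_mx.
Proof.
exact: (@pushforward_semi_sigma_additive _ _ _ _ _ prod_lebesgue _
  measurable_mx_of_tuple).
Qed.

HB.instance Definition _ := isMeasure.Build _ _ _ lebesgue_mx
  lebesgue_mx0 lebesgue_mx_ge0 lebesgue_mx_sigma_additive.

Let lebesgue_mx_sigma_finite : sigma_finite setT lebesgue_mx.
Proof.
apply: (@pushforward_sigma_finite _ _ _ _ _ prod_lebesgue _ _
  measurable_tuple_of_mx mx_of_tupleK).
exact: sigma_finiteT.
Qed.

HB.instance Definition _ :=
  Measure_isSigmaFinite.Build _ _ _ lebesgue_mx lebesgue_mx_sigma_finite.

Lemma lebesgue_mx_box (A : 'I_m -> 'I_n -> set R) :
  (forall i j, measurable (A i j)) ->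
  lebesgue_mx [set X | forall i j, A i j (X i j)] =
  (\prod_i \prod_j lebesgue_measure (A i j))%E.
Proof.
move=> mA; pose B k := A (enum_val (cast_ord (esym (mxvec_cast m n)) k)).1
                         (enum_val (cast_ord (esym (mxvec_cast m n)) k)).2.
have BE i j : B (mxvec_index i j) = A i j.
  by rewrite /B /mxvec_index cast_ordK enum_rankK.
transitivity (\prod_k lebesgue_measure (B k))%E.
  rewrite -(power_measure_box (@lebesgue_measure R)); last first.
    by move=> k; exact: mA.
  rewrite /lebesgue_mx /pushforward; congr (_ _).
  apply/seteqP; split => t /= At => [k|i j].
    by case/mxvec_indexP: k => i j; rewrite BE; have := At i j; rewrite mxE.
  by rewrite mxE -BE.
rewrite pair_bigA (reindex _ (@curry_mxvec_bij m n))/=.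
by apply: eq_bigr => -[i j] _; rewrite /= BE.
Qed.

End matrix_measurable.

Section geometry.
Context {R : realType} {d : nat}.
Implicit Types (x y t : 'rV[R]_d) (A B : set 'rV[R]_d) (r : R).

Definition enorm x : R := Num.sqrt (\sum_j x 0 j ^+ 2).

Definition eball x r : set 'rV[R]_d := [set y | enorm (y - x) <= r].

Definition eball_union k (X : 'M[R]_(k, d)) r : set 'rV[R]_d :=
  \bigcup_i eball (row i X) r.

Definition window (n : nat) : set 'rV[R]_d :=
  [set x | forall j, `|x 0 j| <= n%:R `^ (d%:R^-1) / 2].

Definition translate t A : set 'rV[R]_d := [set t + x | x in A].

Definition distinct_rows k (X : 'M[R]_(k, d)) := injective (fun i => row i X).

Definition distinct_tuples k A : set 'M[R]_(k, d) :=
  [set X | (forall i, A (row i X)) /\ distinct_rows X].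

Definition geometric_edge r : rel 'rV[R]_d :=
  [rel x y | (x != y) && (enorm (x - y) <= r)].

Definition connected_graph k (Gamma : rel 'I_k) :=
  [/\ symmetric Gamma, irreflexive Gamma & forall i j, connect Gamma i j].

(* Gamma is isomorphic to G({x_1, ..., x_k}, r). The vertices of the latter    *)
(* are the rows of X as a set, so no X with a repeated row satisfies this.     *)
Definition geometric_iso k (Gamma : rel 'I_k) r (X : 'M[R]_(k, d)) :=
  exists phi : 'I_k -> 'rV[R]_d,
    set_bij [set: 'I_k] (range (fun i => row i X)) phi /\
    forall i j, geometric_edge r (phi i) (phi j) = Gamma i j.

Definition h_graph k (Gamma : rel 'I_k) r (X : 'M[R]_(k, d)) : R :=
  `[< geometric_iso Gamma r X >]%:R.

End geometry.

Section point_process.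
Context {R : realType} {d : nat} {disp : measure_display}.
Context {T : measurableType disp} (P : probability T R).
Variable Phi : T -> set 'rV[R]_d.

Definition count_event : set (set (set 'rV[R]_d)) :=
  [set E | exists (B : set 'rV[R]_d) (n : nat), measurable B /\
    E = [set phi | counting (phi `&` B) = n%:R%:E :> \bar R]].

Definition configuration := g_sigma_algebraType count_event.

Definition locally_finite (A : set 'rV[R]_d) :=
  forall B, bounded_set B -> finite_set (A `&` B).

Definition point_process :=
  (forall w, locally_finite (Phi w)) /\
  measurable_fun [set: T] (Phi : T -> configuration).

Definition stationary := forall (t : 'rV[R]_d) (E : set configuration),
  measurable E ->
  pushforward P (fun w => translate t (Phi w) : configuration) E =
  pushforward P (Phi : T -> configuration) E.

Definition intensity_measure k (A : set 'M[R]_(k, d)) : \bar R :=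
  (\int[P]_w counting (distinct_tuples (Phi w) `&` A))%E.

Definition unit_intensity := forall A : set 'rV[R]_d, measurable A ->
  intensity_measure A = lebesgue_mx A.

Definition joint_intensity k (rho : 'M[R]_(k, d) -> R) :=
  [/\ measurable_fun setT rho, forall X, 0 <= rho X &
   forall A, measurable A ->
     intensity_measure A = (\int[lebesgue_mx]_(X in A) (rho X)%:E)%E].

Definition feasible k (Gamma : rel 'I_k) (rho : 'M[R]_(k, d) -> R) :=
  (0 < \int[lebesgue_mx]_X (h_graph Gamma 1 X * rho X)%:E)%E.

Definition subgraph_count (r : nat -> R) n k (Gamma : rel 'I_k) (w : T) : R :=
  k`!%:R^-1 * \sum_(X \in distinct_tuples (Phi w `&` window n))
    h_graph Gamma (r n) X.

Definition isolated_count (r : nat -> R) n k (Gamma : rel 'I_k) (w : T) : R :=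
  k`!%:R^-1 * \sum_(X \in distinct_tuples (Phi w `&` window n))
    h_graph Gamma (r n) X *
    `[< counting (Phi w `&` window n `&` eball_union X (r n)) =
        k%:R%:E :> \bar R >]%:R.

End point_process.

Section scaling.
Context {R : realType} {d m : nat}.
Implicit Types (rho g : 'M[R]_(m.+1, d) -> R) (f : R -> R).

(* A joint intensity is a priori only defined almost everywhere; for a         *)
(* stationary process its values on the null set {x_1 = 0} make sense for the  *)
(* versions that only depend on the differences of the points.                 *)
Definition translation_invariant rho :=
  forall (t : 'rV[R]_d) X, rho (X + \matrix_(i, j) t 0 j) = rho X.

Definition ball_power : set 'M[R]_(m.+1, d) :=
  [set y | forall i, eball 0 m.+1%:R (row i y)].

(* y = (0, y_2, ..., y_k) in (B_0(k))^k with pairwise distinct points: at      *)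
(* y = 0 the function r |-> rho (r *: y) is constant, so that asking there for *)
(* rho (r *: y) = Theta(f r) with rho 0 = 0 would force f = 0 near 0.          *)
Definition rooted_tuples : set 'M[R]_(m.+1, d) :=
  [set y | [/\ row ord0 y = 0, ball_power y & distinct_rows y]].

(* rho (r *: y) = Theta(f r) as r -> 0+, with an upper constant uniform in y.  *)
(* The lower constant depends on y: typically rho (r *: y) is close to         *)
(* r ^+ p * g y where g y -> 0 as two points of y merge.                       *)
Definition scales_as rho f :=
  [/\ forall r, 0 <= r -> 0 <= f r,
      forall y, rooted_tuples y ->
        (fun r => rho (r *: y) : R^o) =Theta_(0^'+) (f : R -> R^o) &
      exists C, \forall r \near 0^'+, forall y, rooted_tuples y ->
        rho (r *: y) <= C * f r].

Definition scaling_limit rho f g :=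
  (forall y, ball_power y -> 0 <= g y) /\
  (forall y, rooted_tuples y -> rho (r *: y) / f r @[r --> 0^'+] --> g y).

Definition ae_continuous_on (A : set 'M[R]_(m.+1, d)) g :=
  {ae (@lebesgue_mx R m.+1 d), forall y, A y -> {for y, continuous g}}.

(* (y_2, ..., y_k) |-> (0, y_2, ..., y_k) *)
Definition with_origin (y : 'M[R]_(m, d)) : 'M[R]_(m.+1, d) :=
  col_mx (0 : 'rV_d) y.

Definition mu0 (Gamma : rel 'I_m.+1) g : \bar R :=
  if m == 0 then 1%E else
  ((m.+1)`!%:R^-1%:E *
   \int[@lebesgue_mx R m d]_y
     (h_graph Gamma 1 (with_origin y) * g (with_origin y))%:E)%E.

End scaling.

Definition normalized_limit {R : realType} {disp} {T : measurableType disp}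
    (P : probability T R) (d m : nat) (r : nat -> R) (f : R -> R)
    (N : nat -> T -> R) (l : \bar R) :=
  ('E_P[N n] * ((n%:R * r n ^+ (d * m) * f (r n))^-1)%:E)%E @[n --> \oo] --> l.

(* Main.v *)
Require Import Defs.
From mathcomp Require Import all_boot all_order fingroup perm all_algebra finmap.
From mathcomp Require Import all_classical all_reals all_analysis.
From mathcomp Require Import measurable_realfun ring lra.

(** Let k = m + 1. A tuple of k distinct points whose geometric graph at radius
    r is connected stays within distance m * r of its first point. It is thus
    given by a root x and a bounded shape y, the other points being x + r y_i.
    In these coordinates Lebesgue measure is r ^ (d m) dx dy
    ([ge0_integral_place]), and the joint intensity at the tuple, which only
    depends on differences, is rho (r (0, y)). The root is only constrained by
    the window, so the mean of G_n is
      r ^ (d m) / k! * int h (0, y) rho (r (0, y)) V_n (y) dy,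
    where V_n (y) is the volume of the roots that keep the tuple in the window
    ([mean_shape_count]). After division by n r ^ (d m) f (r) the integrand
    tends to h g, since V_n (y) / n tends to 1 ([room_fraction_cvg]), and it is
    bounded by a constant on a cube and by 0 elsewhere; dominated convergence
    gives the limit of the means of G_n ([cvg_subgraph_count]).

    A copy of the graph that G_n counts and J_n does not has a further point of
    the process within r of one of its vertices. Rooted at that point it is a
    tuple of k + 1 distinct points within (k + 1) r of the root
    ([extend_not_isolated]). The mean number of such tuples is
    O(n r ^ (d m + d) f (r)), because f^{k+1} = O(f^k), and this is smaller than
    the normalization by a factor r ^ d ([extended_count_le]). Hence both means
    have the same limit ([cvg_isolated_count]).

    Means are integrals over the probability space. The number of tuples of
    points in a measurable set is a random variable, by Dynkin's induction from
    product sets ([measurable_tuple_count]). The variable J_n is enclosed between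
    measurable ones, and integrals of nonnegative functions are monotone
    ([le_integral_nonmeasurable], [le_integralD_nonmeasurable]).

    For k = 1 the intensity is the constant 1 ([unit_intensity_density]), so
    that the case of an intensity vanishing at 0 does not occur. *)

Set Implicit Arguments.
Unset Strict Implicit.
Unset Printing Implicit Defensive.

Import Order.TTheory GRing.Theory Num.Theory.
Import numFieldNormedType.Exports.

Local Open Scope classical_set_scope.
Local Open Scope ring_scope.

(** * Lebesgue measure on the line and on matrices *)

Section lebesgue_affine.
Context {R : realType}.
Local Notation mu := (@lebesgue_measure R).

Lemma measurable_affine (a r : R) :
  measurable_fun [set: measurableTypeR R]
    ((fun y => a + r * y) : measurableTypeR R -> measurableTypeR R).
Proof. by apply: measurable_funD => //; exact: measurable_funM. Qed.

(** Multiplied by r, the left-hand side is a measure in A that agrees with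
    Lebesgue measure on half-open intervals. *)
Lemma lebesgue_measure_affine (a r : R) (A : set R) : 0 < r -> measurable A ->
  mu [set y | A (a + r * y)] = (r^-1%:E * mu A)%E.
Proof.
move=> r0 mA; have r0' : 0 <= r by exact: ltW.
have maff := measurable_affine a r.
pose nu1 : {measure set (measurableTypeR R) -> \bar R} := pushforward mu
  ((fun y => a + r * y) : measurableTypeR R -> measurableTypeR R).
pose nu2 : {measure set (measurableTypeR R) -> \bar R} :=
  mscale (NngNum r0') (nu1 maff).
suff -> : mu A = nu2 A.
  rewrite /nu2/= /mscale/= muleA -EFinM mulVf ?mul1e//; exact: lt0r_neq0.
apply: lebesgue_measure_unique => // _ [[b c] _ <-].
rewrite /nu2/= /mscale/= /pushforward/=.
rewrite [X in (_ = _ * mu X)%E](_ : _ = `](b - a) / r, (c - a) / r]%classic); last first.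
  by apply/seteqP; split => y /=;
    rewrite !in_itv/= ltr_pdivrMr// ler_pdivlMr// ltrBlDl lerBrDl (mulrC y).
rewrite !lebesgue_measure_itv/= !lte_fin ltr_pM2r ?invr_gt0// ltrD2r.
case: ifPn => bc; last by rewrite mule0.
by rewrite -EFinD -EFinM; congr EFin; field; exact: lt0r_neq0.
Qed.

End lebesgue_affine.

Section matrix_sigma_algebra.
Context {R : realType}.

Definition mx_box m n (A : 'I_m -> 'I_n -> set R) : set 'M[R]_(m, n) :=
  [set X | forall i j, A i j (X i j)].

(** Boxes form a pi-system that generates the sigma-algebra of matrices; both
    uniqueness of measures and Dynkin's induction start from them. *)
Definition mx_boxes m n : set (set 'M[R]_(m, n)) :=
  [set B | exists A : 'I_m -> 'I_n -> set R,
    (forall i j, measurable (A i j)) /\ B = mx_box A].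

Lemma measurable_to_mx d (T : measurableType d) m n (F : T -> 'M[R]_(m, n)) :
  (forall i j, measurable_fun setT (fun t => F t i j)) ->
  measurable_fun setT F.
Proof.
move=> mF; apply: (@measurability _ _ _ _ _ _ mx_cylinder) => //.
move=> _ [_ [i [j [B [mB ->]]]] <-]; exact: mF.
Qed.

Lemma measurable_mx_box m n (A : 'I_m -> 'I_n -> set R) :
  (forall i j, measurable (A i j)) -> measurable (mx_box A).
Proof.
move=> mA; rewrite (_ : mx_box A = \bigcap_(ij in [set: 'I_m * 'I_n])
    [set X : 'M[R]_(m, n) | A ij.1 ij.2 (X ij.1 ij.2)]).
  apply: fin_bigcap_measurable => // -[i j] _ /=.
  by rewrite -[X in measurable X]setTI; exact: measurable_mx_entry.
by apply/seteqP; split => [X AX [i j] _|X AX i j]; [exact: AX|exact: (AX (i, j))].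
Qed.

Lemma mx_boxes_setI m n : setI_closed (@mx_boxes m n).
Proof.
move=> _ _ [A [mA ->]] [B [mB ->]].
exists (fun i j => A i j `&` B i j); split=> [i j|]; first exact: measurableI.
apply/seteqP; split => [X [AX BX] i j|X ABX]; first by split; [exact: AX|exact: BX].
by split => i j; have [] := ABX i j.
Qed.

Lemma measurable_mxE m n : @measurable _ 'M[R]_(m, n) = <<s @mx_boxes m n >>.
Proof.
apply/seteqP; split; last first.
  apply: smallest_sub; first exact: sigma_algebra_measurable.
  by move=> _ [A [mA ->]]; exact: measurable_mx_box.
apply: smallest_sub; first exact: smallest_sigma_algebra.
move=> _ [i [j [B [mB ->]]]]; apply: sub_sigma_algebra.
exists (fun i' j' => if (i' == i) && (j' == j) then B else setT); split.
  by move=> i' j'; case: ifP.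
apply/seteqP; split => [X BX i' j'|X /(_ i j)]; last by rewrite !eqxx.
by case: ifPn => // /andP[/eqP -> /eqP ->].
Qed.

Definition mx_cube m n (N : R) : set 'M[R]_(m, n) :=
  mx_box (fun=> fun=> `[- N, N]%classic).

Lemma mx_cubeP m n N (X : 'M[R]_(m, n)) :
  mx_cube N X <-> forall i j, `|X i j| <= N.
Proof.
by split => XN i j; have := XN i j; rewrite /= in_itv/= ler_norml.
Qed.

Lemma lebesgue_mx_cube m n (N : R) : 0 <= N ->
  lebesgue_mx (@mx_cube m n N) = ((2 * N) ^+ (m * n))%:E.
Proof.
move=> N0; rewrite lebesgue_mx_box// mulnC exprM.
have -> : lebesgue_measure `[- N, N]%classic = (2 * N)%:E.
  rewrite lebesgue_measure_itv/= lte_fin; case: ifPn => [_|].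
    by rewrite -EFinB; congr EFin; ring.
  rewrite -leNgt => NN; suff -> : N = 0 by rewrite mulr0.
  by apply/eqP; rewrite eq_le N0 andbT; move: NN; lra.
under eq_bigr => i _ do rewrite -(big_morph EFin EFinM erefl).
by rewrite -(big_morph EFin EFinM erefl) !prodr_const !card_ord.
Qed.

Lemma mx_cube_cover m n : \bigcup_N @mx_cube m n N%:R = setT.
Proof.
apply/seteqP; split => // X _.
have [N XN] : exists N : nat, \sum_i \sum_j `|X i j| <= N%:R.
  by exists (Num.bound (\sum_i \sum_j `|X i j|)); apply/ltW/archi_boundP;
    do 2 (apply: sumr_ge0 => ? _).
exists N => //; apply/mx_cubeP => i j; apply: le_trans XN.
rewrite (bigD1 i)//= (bigD1 j)//= -addrA lerDl addr_ge0//.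
  by apply: sumr_ge0.
by do 2 (apply: sumr_ge0 => ? _).
Qed.

(** Cubes are boxes of finite measure that exhaust the space, so the values on
    the pi-system of boxes determine the measure. *)
Lemma lebesgue_mx_unique m n (mu : {measure set 'M[R]_(m, n) -> \bar R}) :
  (forall A : 'I_m -> 'I_n -> set R, (forall i j, measurable (A i j)) ->
    mu (mx_box A) = (\prod_i \prod_j lebesgue_measure (A i j))%E) ->
  forall B, measurable B -> lebesgue_mx B = mu B.
Proof.
move=> muE B mB; apply: (@measure_unique _ R _ (@mx_boxes m n)
  (fun N => mx_cube N%:R)) => //.
- exact: measurable_mxE.
- exact: mx_boxes_setI.
- by move=> N; exists (fun=> fun=> `[- N%:R, N%:R]%classic); split.
- exact: mx_cube_cover.
- by move=> _ [A [mA ->]]; rewrite muE//; exact: lebesgue_mx_box.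
- by move=> N; have /= -> := @lebesgue_mx_cube m n N%:R (ler0n R N); rewrite ltry.
Qed.

End matrix_sigma_algebra.

(** * Root and shape coordinates *)

Section root_coordinates.
Context {R : realType} {d m : nat}.

Lemma with_origin0 (y : 'M[R]_(m, d)) j : with_origin y ord0 j = 0.
Proof.
transitivity (col_mx (0 : 'rV[R]_d) y (lshift m ord0) j).
  by congr fun_of_matrix; exact: val_inj.
by rewrite col_mxEu mxE.
Qed.

Lemma with_originS (y : 'M[R]_(m, d)) i j : with_origin y (lift ord0 i) j = y i j.
Proof.
transitivity (col_mx (0 : 'rV[R]_d) y (rshift 1 i) j).
  by congr fun_of_matrix; exact: val_inj.
by rewrite col_mxEd.
Qed.

(** The configuration with root x and shape y at scale r: its rows are x and
    the x + r y_i. *)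
Definition place (r : R) (p : 'rV[R]_d * 'M[R]_(m, d)) : 'M[R]_(m.+1, d) :=
  \matrix_(i, j) (p.1 0 j + r * with_origin p.2 i j).

Lemma placeE r x (y : 'M[R]_(m, d)) i j :
  place r (x, y) i j = x 0 j + r * with_origin y i j.
Proof. by rewrite mxE. Qed.

Lemma measurable_with_origin :
  measurable_fun setT (with_origin : 'M[R]_(m, d) -> 'M[R]_(m.+1, d)).
Proof.
apply: measurable_to_mx => i j; case: (unliftP ord0 i) => [i'|] ->.
  by under eq_fun do rewrite with_originS; exact: measurable_mx_entry.
by under eq_fun do rewrite with_origin0; exact: measurable_cst.
Qed.

Lemma measurable_place r : measurable_fun setT (place r).
Proof.
apply: measurable_to_mx => i j; under eq_fun do rewrite mxE.
apply: measurable_funD.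
  exact: (measurableT_comp (measurable_mx_entry 0 j) measurable_fst).
apply: measurable_funM => //.
exact: (measurableT_comp (measurable_mx_entry i j)
  (measurableT_comp measurable_with_origin measurable_snd)).
Qed.

Local Notation mu1 := (@lebesgue_mx R 1 d).
Local Notation mum := (@lebesgue_mx R m d).

(** For a fixed root, the shapes that put the points in a given box form a box
    again, each of its m * d sides being divided by r; the factor in front
    makes up for this. *)
Lemma lebesgue_mx_place_box r (A : 'I_m.+1 -> 'I_d -> set R) : 0 < r ->
  (forall i j, measurable (A i j)) ->
  ((r ^+ (m * d))%:E * (mu1 \x mum) (place r @^-1` mx_box A) =
  \prod_i \prod_j lebesgue_measure (A i j))%E.
Proof.
move=> r0 mA.
pose c := (\prod_(i < m) \prod_(j < d)
  (r^-1%:E * lebesgue_measure (A (lift ord0 i) j)))%E.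
have c0 : (0 <= c)%E.
  apply: prode_ge0 => i _; apply: prode_ge0 => j _.
  by rewrite mule_ge0// lee_fin invr_ge0 ltW.
pose A0 : set 'rV[R]_d := mx_box (fun=> A ord0).
have mA0 : measurable A0 by exact: measurable_mx_box.
have -> : ((mu1 \x mum) (place r @^-1` mx_box A) = c * mu1 A0)%E.
  rewrite -(integral_cst mu1 mA0) integral_mkcond.
  apply: eq_integral => x _ /=; rewrite patchE.
  case: ifPn => [/set_mem xA0|/negP xA0].
    have -> : xsection (place r @^-1` mx_box A) x =
        mx_box (fun i j => [set y | A (lift ord0 i) j (x 0 j + r * y)]).
      apply/seteqP; split => y; rewrite /xsection/= inE/=.
        by move=> Ay i j; have := Ay (lift ord0 i) j; rewrite /= mxE with_originS.
      move=> Ay i j; rewrite mxE; case: (unliftP ord0 i) => [i'|] ->.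
        by rewrite with_originS; exact: Ay.
      by rewrite with_origin0 mulr0 addr0; exact: xA0.
    rewrite [LHS]lebesgue_mx_box; last first.
      move=> i j; rewrite -[X in measurable X]setTI.
      exact: (measurable_affine (x 0 j) r measurableT (mA (lift ord0 i) j)).
    by apply: eq_bigr => i _; apply: eq_bigr => j _; rewrite lebesgue_measure_affine.
  rewrite (_ : xsection _ _ = set0) ?measure0//.
  apply/seteqP; split => y //; rewrite /xsection/= inE => Ay.
  apply: xA0; rewrite inE => i j; have := Ay ord0 j.
  by rewrite mxE with_origin0 mulr0 addr0 (ord1 i).
rewrite [mu1 A0]lebesgue_mx_box// big_ord1 big_ord_recl /c.
have -> : (\prod_(i < m) \prod_(j < d)
    (r^-1%:E * lebesgue_measure (A (lift ord0 i) j)) =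
    (r^-1 ^+ (m * d))%:E *
    \prod_(i < m) \prod_(j < d) lebesgue_measure (A (lift ord0 i) j))%E.
  under eq_bigr do rewrite big_split/=.
  rewrite big_split/=; congr (_ * _)%E.
  under eq_bigr => i _ do rewrite -(big_morph EFin EFinM erefl).
  by rewrite -(big_morph EFin EFinM erefl) !prodr_const !card_ord mulnC exprM.
rewrite !muleA -EFinM exprVn divff ?mul1e; first by rewrite muleC.
by rewrite expf_neq0// gt_eqF.
Qed.

Lemma lebesgue_mx_place r (B : set 'M[R]_(m.+1, d)) : 0 < r -> measurable B ->
  lebesgue_mx B = ((r ^+ (m * d))%:E * (mu1 \x mum) (place r @^-1` B))%E.
Proof.
move=> r0 mB; have r0' : 0 <= r ^+ (m * d) by rewrite exprn_ge0// ltW.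
pose nu1 : {measure set _ -> \bar R} := pushforward (mu1 \x mum)%E (place r).
pose nu2 : {measure set _ -> \bar R} :=
  mscale (NngNum r0') (nu1 (measurable_place r)).
apply: (@lebesgue_mx_unique _ _ _ nu2) => // A mA.
exact: lebesgue_mx_place_box.
Qed.

(** The substitution (x, y) |-> (x, x + r y_1, ..., x + r y_m), with the root
    integrated first: an integrand that is constant in the root up to an
    indicator then leaves only the volume of the admissible roots. *)
Lemma ge0_integral_place r (F : 'M[R]_(m.+1, d) -> \bar R) : 0 < r ->
  measurable_fun setT F -> (forall X, 0 <= F X)%E ->
  (\int[lebesgue_mx]_X F X =
   (r ^+ (m * d))%:E * \int[mum]_y \int[mu1]_x F (place r (x, y)))%E.
Proof.
move=> r0 mF F0; have r0' : 0 <= r ^+ (m * d) by rewrite exprn_ge0// ltW.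
pose nu1 : {measure set _ -> \bar R} := pushforward (mu1 \x mum)%E (place r).
pose nu2 : {measure set _ -> \bar R} :=
  mscale (NngNum r0') (nu1 (measurable_place r)).
transitivity (\int[nu2]_X F X)%E.
  by apply: eq_measure_integral => A mA _; exact: lebesgue_mx_place.
rewrite ge0_integral_mscale//; congr (_ * _)%E.
rewrite ge0_integral_pushforward//; last exact: measurable_place.
have mFp : measurable_fun setT (F \o place r).
  exact: measurableT_comp (measurable_place r).
by rewrite preimage_setT fubini_tonelli2 // => p; exact: F0.
Qed.

End root_coordinates.

(** * Counting tuples of points *)

Section counting_tuples.
Context {R : realType}.

Lemma counting_seq (T : choiceType) (s : seq T) (A : set T) : uniq s ->
  counting ([set` s] `&` A) = (\sum_(x <- s) `[<A x>]%:R)%:E :> \bar R.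
Proof.
move=> us; pose t := [seq x <- s | `[<A x>]].
have -> : [set` s] `&` A = [set` [fset x in t]%fset].
  apply/seteqP; split => x /=; rewrite !inE/= mem_filter.
    by case=> -> /asboolP ->.
  by case/andP => /asboolP.
rewrite /counting asboolT; last exact: finite_fset.
rewrite set_fsetK card_fseq undup_id ?filter_uniq// size_filter -sum1_count.
by rewrite natr_sum big_mkcond; congr EFin; apply: eq_bigr => x _; case: asboolP.
Qed.

Variables d k : nat.
Implicit Types (F : set 'rV[R]_d) (B : 'I_k -> set 'rV[R]_d).

Definition tuples_in F : set 'M[R]_(k, d) := [set X | forall i, F (row i X)].

Definition row_box B : set 'M[R]_(k, d) := [set X | forall i, B i (row i X)].

(** Maps into the positions of a duplicate-free list enumerate the tuples of
    its elements, repetitions allowed, without redundancy. *)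
Definition tuple_mx (s : seq 'rV[R]_d) (phi : {ffun 'I_k -> 'I_(size s)}) :
  'M[R]_(k, d) := \matrix_(i, j) s`_(phi i) 0 j.

Lemma row_tuple_mx s (phi : {ffun 'I_k -> 'I_(size s)}) i :
  row i (tuple_mx phi) = s`_(phi i).
Proof. by apply/rowP => j; rewrite !mxE. Qed.

Lemma tuple_mx_inj s : uniq s -> injective (@tuple_mx s).
Proof.
move=> us phi psi /(congr1 (fun X i => row i X)) e; apply/ffunP => i.
move: e => /(congr1 (@^~ i)); rewrite !row_tuple_mx => /eqP.
by rewrite nth_uniq// => /eqP /val_inj.
Qed.

Lemma tuples_in_seq s : tuples_in [set` s] =
  [set` [seq tuple_mx phi | phi <- enum {ffun 'I_k -> 'I_(size s)}]].
Proof.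
apply/seteqP; split => [X sX|_ /= /mapP[phi _ ->] i]; last first.
  by rewrite row_tuple_mx /=; exact: mem_nth.
have ltX i : (index (row i X) s < size s)%N by rewrite index_mem; exact: sX.
apply/mapP; exists [ffun i => Ordinal (ltX i)]; first by rewrite mem_enum.
apply/row_matrixP => i; rewrite row_tuple_mx ffunE/= nth_index//; exact: sX.
Qed.

Lemma finite_tuples_in F : finite_set F -> finite_set (tuples_in F).
Proof. by move=> /finite_seqP[s ->]; rewrite tuples_in_seq. Qed.

(** With repetitions allowed, the number of tuples in a product set is the
    product of the numbers of points, and these are random variables by
    definition of a point process. *)
Lemma counting_row_box F B : finite_set F ->
  counting (tuples_in F `&` row_box B) =
  (\prod_i fine (counting (F `&` B i)))%:E :> \bar R.
Proof.
move=> /finite_seqP[s0 ->].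
have -> : [set` s0] = [set` undup s0].
  by apply/seteqP; split => x /=; rewrite mem_undup.
have us := undup_uniq s0; set s := undup s0 in us *.
rewrite tuples_in_seq counting_seq; last first.
  by rewrite map_inj_uniq ?enum_uniq//; exact: tuple_mx_inj.
congr EFin; under [RHS]eq_bigr => i _ do rewrite counting_seq//= (big_nth 0) big_mkord.
rewrite bigA_distr_bigA/= big_map big_enum; apply: eq_bigr => phi _.
under [RHS]eq_bigr => i _ do rewrite -(row_tuple_mx phi i).
case: asboolP => [Bphi|nB].
  by rewrite big1// => i _; rewrite asboolT//; exact: Bphi.
have /existsNP[i Bi] := nB.
by apply/esym/eqP; rewrite prodf_seq_eq0; apply/hasP; exists i;
  rewrite ?mem_index_enum//= asboolF.
Qed.

End counting_tuples.

(** * Measurability of sets of configurations *)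

Section measurable_geometry.
Context {R : realType} {d : nat}.

Lemma measurable_row k (i : 'I_k) :
  measurable_fun setT (fun X : 'M[R]_(k, d) => row i X).
Proof.
apply: measurable_to_mx => i' j; under eq_fun do rewrite mxE.
exact: measurable_mx_entry.
Qed.

Lemma measurable_mx1 k (X : 'M[R]_(k, d)) : measurable [set X].
Proof.
rewrite (_ : [set X] = mx_box (fun i j => [set X i j])).
  by apply: measurable_mx_box => i j.
by apply/seteqP; split => [_ -> //|Y YX]; apply/matrixP => i j; exact: YX.
Qed.

Lemma finite_measurable_mx k (A : set 'M[R]_(k, d)) :
  finite_set A -> measurable A.
Proof.
move=> fA; apply: countable_measurable; first exact: measurable_mx1.
exact: finite_set_countable.
Qed.

Lemma measurable_row_box k (B : 'I_k -> set 'rV[R]_d) :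
  (forall i, measurable (B i)) -> measurable (row_box B).
Proof.
move=> mB; rewrite (_ : row_box B = \bigcap_(i in [set: 'I_k])
    ((fun X : 'M[R]_(k, d) => row i X) @^-1` B i)).
  apply: fin_bigcap_measurable => // i _.
  by rewrite -[X in measurable X]setTI; exact: measurable_row.
by apply/seteqP; split => [X BX i _|X BX i]; exact: BX.
Qed.

(** Products of measurable sets of points are the pi-system on which counts of
    tuples can be computed. *)
Lemma measurable_mx_rowE k : @measurable _ 'M[R]_(k, d) =
  <<s [set A | exists B : 'I_k -> set 'rV[R]_d,
         (forall i, measurable (B i)) /\ A = row_box B] >>.
Proof.
apply/seteqP; split; last first.
  apply: smallest_sub; first exact: sigma_algebra_measurable.
  by move=> _ [A [mA ->]]; exact: measurable_row_box.
rewrite measurable_mxE; apply: smallest_sub; first exact: smallest_sigma_algebra.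
move=> _ [A [mA ->]]; apply: sub_sigma_algebra.
exists (fun i => mx_box (fun=> A i)); split.
  by move=> i; exact: measurable_mx_box.
apply/seteqP; split => [X AX i i' j|X AX i j]; first by rewrite mxE; exact: AX.
by have := AX i 0 j; rewrite mxE.
Qed.

Lemma windowE n : @window R d n = mx_cube (n%:R `^ d%:R^-1 / 2).
Proof.
apply/seteqP; split => [x Wx|x /mx_cubeP Wx j]; last exact: Wx.
by apply/mx_cubeP => i j; rewrite (ord1 i); exact: Wx.
Qed.

Lemma measurable_cube m n (N : R) : measurable (@mx_cube R m n N).
Proof. by apply: measurable_mx_box => i j. Qed.

Lemma measurable_window n : measurable (@window R d n).
Proof. by rewrite windowE; exact: measurable_cube. Qed.

Lemma bounded_window n : bounded_set (@window R d n).
Proof.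
exists (n%:R `^ d%:R^-1 / 2); split; first exact: num_real.
move=> M ltM x Wx; rewrite /= /Num.norm/= mx_normrE; apply: bigmax_le => [|[i j] _].
  by apply: le_trans (ltW ltM); rewrite divr_ge0// powR_ge0.
by rewrite /= (ord1 i); apply: le_trans (ltW ltM); exact: Wx.
Qed.

Lemma measurable_distinct_rows k :
  measurable (@distinct_rows R d k : set 'M[R]_(k, d)).
Proof.
rewrite (_ : @distinct_rows R d k = \bigcap_(ij in [set ij : 'I_k * 'I_k | ij.1 != ij.2])
    \bigcup_(l in [set: 'I_d]) ~` [set X : 'M[R]_(k, d) | X ij.1 l = X ij.2 l]).
  apply: fin_bigcap_measurable => // -[i j] /= ij.
  apply: fin_bigcup_measurable => // l _; apply: measurableC.
  rewrite (_ : [set _ | _] =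
      (fun X : 'M[R]_(k, d) => X i l - X j l) @^-1` [set 0]).
    rewrite -[X in measurable X]setTI; apply: measurable_funB => //;
    exact: measurable_mx_entry.
  apply/seteqP; split => X /=; first by move=> ->; rewrite subrr.
  by move/eqP; rewrite subr_eq0 => /eqP.
apply/seteqP; split => [X dX [i j] /= ij|X dX i j /= eij].
  apply: contrapT => nl; move/eqP: ij; apply; apply: dX; apply/rowP => l.
  by rewrite !mxE; apply: contrapT => Xl; apply: nl; exists l.
apply/eqP/negPn/negP => ij; have [l _ /=] := dX (i, j) ij.
by apply; move/rowP: eij => /(_ l); rewrite !mxE.
Qed.

End measurable_geometry.

(** * Measurability of the number of tuples *)

Section measurable_counts.
Context {R : realType} {d : nat} {disp : measure_display}.
Context {T : measurableType disp}.
Variable Phi : T -> set 'rV[R]_d.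
Hypothesis Phi_pp : point_process Phi.

Lemma finite_in_window w n : finite_set (Phi w `&` window n).
Proof. by apply: (Phi_pp.1 w); exact: bounded_window. Qed.

(** A count only takes natural values, so its preimages are countable unions
    of the events that generate the sigma-algebra of configurations. *)
Lemma measurable_count n B : measurable B ->
  measurable_fun setT (fun w => counting (Phi w `&` window n `&` B) : \bar R).
Proof.
move=> mB _ Y mY; rewrite setTI.
pose E k : set (set 'rV[R]_d) :=
  [set phi | counting (phi `&` (window n `&` B)) = k%:R%:E :> \bar R].
rewrite (_ : _ @^-1` Y = \bigcup_(k in [set k : nat | Y k%:R%:E]) (Phi @^-1` E k)).
  apply: bigcup_measurable => k _; rewrite -[X in measurable X]setTI.
  apply: Phi_pp.2 => //; apply: sub_sigma_algebra; exists (window n `&` B), k.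
  by split => //; apply: measurableI => //; exact: measurable_window.
apply/seteqP; split => [w /= Yw|w [k /= Yk]]; last by rewrite /E/= setIA => ->.
have fw : finite_set (Phi w `&` window n `&` B).
  by apply: sub_finite_set (finite_in_window w n); exact: subIsetl.
exists #|` fset_set (Phi w `&` window n `&` B)|.
  by move: Yw; rewrite /= /counting asboolT.
by rewrite /E/= setIA /counting asboolT.
Qed.

Variable k : nat.

(** Dynkin induction on A, starting from products. Restricting to a window
    makes the counts finite, and complements become differences. *)
Lemma measurable_tuple_count n (A : set 'M[R]_(k, d)) : measurable A ->
  measurable_fun setT
    (fun w => counting (tuples_in (k := k) (Phi w `&` window n) `&` A) : \bar R).
Proof.
move=> mA; pose F w := Phi w `&` window n.
have fF w : finite_set (tuples_in (k := k) (F w)).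
  exact/finite_tuples_in/finite_in_window.
have fFI w (B : set 'M[R]_(k, d)) : finite_set (tuples_in (F w) `&` B).
  by apply: sub_finite_set (fF w); exact: subIsetl.
pose G : set (set 'M[R]_(k, d)) := [set A | exists B : 'I_k -> set 'rV[R]_d,
  (forall i, measurable (B i)) /\ A = row_box B].
have box B : (forall i, measurable (B i)) -> measurable_fun setT
    (fun w => counting (tuples_in (F w) `&` row_box B) : \bar R).
  move=> mB.
  under eq_fun => w do rewrite (counting_row_box _ (finite_in_window w n)).
  apply/measurable_EFinP; apply: measurable_prod => i _.
  by apply: measurableT_comp => //; exact: measurable_count.
have full : setT = row_box (fun=> setT) :> set 'M[R]_(k, d).
  by apply/seteqP; split.
apply: (@dynkin_induction _ _ G
  (fun A => measurable_fun setT (fun w => counting (tuples_in (F w) `&` A) : \bar R))).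
- exact: measurable_mx_rowE.
- move=> _ _ [B [mB ->]] [C [mC ->]]; exists (fun i => B i `&` C i).
  split=> [i|]; first exact: measurableI.
  apply/seteqP; split => [X [BX CX] i|X BCX]; first by split; [exact: BX|exact: CX].
  by split => i; have [] := BCX i.
- by rewrite full; apply: box.
- by move=> _ [B [mB ->]]; exact: box.
- move=> S mS PS.
  suff -> : (fun w => counting (tuples_in (F w) `&` ~` S)) = (fun w =>
      counting (tuples_in (F w) `&` [set: 'M[R]_(k, d)]) - counting (tuples_in (F w) `&` S))%E
      :> (T -> \bar R).
    by apply: emeasurable_funB => //; rewrite full; apply: box.
  apply/funext => w; rewrite -(setUv S) setIUr.
  have -> : counting (tuples_in (F w) `&` S `|` tuples_in (F w) `&` ~` S) =
      (counting (tuples_in (F w) `&` S) + counting (tuples_in (F w) `&` ~` S))%E :> \bar R.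
    apply: measureU; [exact: finite_measurable_mx..|].
    by rewrite setIACA setICr setI0.
  by rewrite addeAC subee ?add0e// /counting asboolT.
- move=> S mS tS PS.
  suff -> : (fun w => counting (tuples_in (F w) `&` \bigcup_i S i)) =
      (fun w => \sum_(0 <= i <oo) counting (tuples_in (F w) `&` S i))%E
      :> (T -> \bar R).
    by apply: ge0_emeasurable_sum.
  apply/funext => w; rewrite setI_bigcupr.
  rewrite (measure_semi_bigcup (@counting _ R)) => //=.
  + by move=> i; exact: finite_measurable_mx.
  + exact: trivIset_setIl.
  + exact: bigcup_measurable (fun i _ => finite_measurable_mx (fFI w _)).
- by rewrite -measurable_mx_rowE.
Qed.

(** Distinctness is a measurable condition on the tuple, hence can be moved
    from the tuples that are counted to the set in which they are counted. *)
Lemma measurable_distinct_count n (A : set 'M[R]_(k, d)) : measurable A ->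
  measurable_fun setT (fun w =>
    counting (distinct_tuples (Phi w `&` window n) `&` A) : \bar R).
Proof.
move=> mA; rewrite (_ : (fun w => _) = (fun w => counting
  (tuples_in (Phi w `&` window n) `&` (@distinct_rows R d k `&` A)))).
  by apply: measurable_tuple_count; apply: measurableI => //;
    exact: measurable_distinct_rows.
apply/funext => w; rewrite setIA; congr (counting (_ `&` _)).
Qed.

End measurable_counts.

(** * The Euclidean norm *)

Section euclidean_norm.
Context {R : realType} {d : nat}.
Implicit Types x y : 'rV[R]_d.

Lemma enorm_sum_ge0 x : 0 <= \sum_j x 0 j ^+ 2.
Proof. by apply: sumr_ge0 => j _; exact: sqr_ge0. Qed.

Lemma enorm_ge0 x : 0 <= enorm x.
Proof. exact: sqrtr_ge0. Qed.

Lemma enorm0 : enorm (0 : 'rV[R]_d) = 0.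
Proof. by rewrite /enorm big1 ?sqrtr0// => j _; rewrite mxE expr0n. Qed.

Lemma enormZ (c : R) x : enorm (c *: x) = `|c| * enorm x.
Proof.
rewrite /enorm -sqrtr_sqr -sqrtrM ?sqr_ge0// mulr_sumr.
by congr Num.sqrt; apply: eq_bigr => j _; rewrite mxE exprMn.
Qed.

Lemma enormN x : enorm (- x) = enorm x.
Proof. by rewrite -scaleN1r enormZ normrN1 mul1r. Qed.

Lemma le_coord_enorm x j : `|x 0 j| <= enorm x.
Proof.
rewrite -sqrtr_sqr /enorm ler_sqrt ?enorm_sum_ge0// (bigD1 j)//= lerDl.
by apply: sumr_ge0 => i _; exact: sqr_ge0.
Qed.

(** With a = |x|^2, b = |y|^2, c = <x, y>, the sum of squares |a y - c x|^2 is
    a (a b - c^2). *)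
Lemma cauchy_schwarz_row x y :
  (\sum_j x 0 j * y 0 j) ^+ 2 <= (\sum_j x 0 j ^+ 2) * (\sum_j y 0 j ^+ 2).
Proof.
set a := \sum_j _ ^+ 2; set b := \sum_j y 0 j ^+ 2; set c := \sum_j _ * _.
have a0 : 0 <= a by exact: enorm_sum_ge0.
have h : 0 <= a * (a * b - c ^+ 2).
  have -> : a * (a * b - c ^+ 2) = \sum_j (a * y 0 j - c * x 0 j) ^+ 2.
    transitivity (\sum_j (a ^+ 2 * y 0 j ^+ 2 - 2 * a * c * (x 0 j * y 0 j) +
        c ^+ 2 * x 0 j ^+ 2)); last by apply: eq_bigr => j _; ring.
    by rewrite big_split/= sumrB -!mulr_sumr -/a -/b -/c; ring.
  by apply: sumr_ge0 => j _; exact: sqr_ge0.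
move: a0; rewrite le_eqVlt => /predU1P[a0|a0].
  have x0 j : x 0 j = 0.
    apply/eqP; rewrite -normr_le0; apply: le_trans (le_coord_enorm x j) _.
    by rewrite /enorm -/a -a0 sqrtr0.
  by rewrite -a0 mul0r /c big1 ?expr0n// => j _; rewrite x0 mul0r.
by rewrite -subr_ge0; move: h; rewrite pmulr_rge0.
Qed.

Lemma enormD x y : enorm (x + y) <= enorm x + enorm y.
Proof.
rewrite -(@ler_pXn2r _ 2)// ?nnegrE ?addr_ge0 ?enorm_ge0//.
rewrite sqrrD !sqr_sqrtr ?enorm_sum_ge0//.
under eq_bigr => j _ do rewrite mxE sqrrD.
rewrite !big_split/= lerD2r lerD2l -mulr2n lerMn2r/=.
apply: le_trans (ler_norm _) _; rewrite -sqrtr_sqr -sqrtrM ?enorm_sum_ge0//.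
rewrite ler_sqrt ?mulr_ge0 ?enorm_sum_ge0//; exact: cauchy_schwarz_row.
Qed.

Lemma measurable_enorm : measurable_fun setT (@enorm R d).
Proof.
have msqrt : measurable_fun [set: R] (@Num.sqrt R).
  by apply: continuous_measurable_fun; exact: sqrt_continuous.
apply: (measurableT_comp msqrt); apply: measurable_sum => j.
by apply: measurable_funX; exact: measurable_mx_entry.
Qed.

End euclidean_norm.

(** * Geometric graphs of rooted configurations *)

Section rooted_configurations.
Context {R : realType} {d : nat}.

(** The shape of a configuration: its first point is moved to the origin and
    lengths are divided by r. *)
Definition recenter k (r : R) (X : 'M[R]_(k.+1, d)) : 'M[R]_(k.+1, d) :=
  \matrix_(i, j) (r^-1 * (X i j - X ord0 j)).

Lemma recenter_place k r x (y : 'M[R]_(k, d)) : r != 0 ->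
  recenter r (place r (x, y)) = with_origin y.
Proof.
move=> r0; apply/matrixP => i j.
by rewrite mxE !placeE with_origin0 mulr0 addr0 addrC addKr mulKf.
Qed.

Lemma measurable_recenter k r : measurable_fun setT (@recenter k r).
Proof.
apply: measurable_to_mx => i j; under eq_fun do rewrite mxE.
by apply: measurable_funM => //; apply: measurable_funB; exact: measurable_mx_entry.
Qed.

Lemma row_recenterB k r (X : 'M[R]_(k.+1, d)) i i' :
  row i (recenter r X) - row i' (recenter r X) = r^-1 *: (row i X - row i' X).
Proof. by apply/rowP => j; rewrite !mxE; ring. Qed.

Lemma enorm_recenterB k r (X : 'M[R]_(k.+1, d)) i i' : 0 < r ->
  enorm (row i (recenter r X) - row i' (recenter r X)) =
  enorm (row i X - row i' X) / r.
Proof.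
by move=> r0; rewrite row_recenterB enormZ gtr0_norm ?invr_gt0// mulrC.
Qed.

Lemma distinct_recenter k r (X : 'M[R]_(k.+1, d)) : 0 < r ->
  distinct_rows (recenter r X) <-> distinct_rows X.
Proof.
move=> r0; split => dX i i' /= /eqP; rewrite -subr_eq0 => /eqP e; apply: dX;
  apply/eqP; rewrite -subr_eq0.
- by rewrite row_recenterB e scaler0.
- by move/eqP: e; rewrite row_recenterB scaler_eq0 invr_eq0 gt_eqF.
Qed.

(** An isomorphism with the graph on the set of rows forces the k rows to be
    distinct, and is then a relabelling. This replaces a quantifier over all
    maps by a finite union, which makes the condition measurable. *)
Lemma geometric_isoP k (Gamma : rel 'I_k) r (X : 'M[R]_(k, d)) :
  geometric_iso Gamma r X <-> distinct_rows X /\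
  exists s : {perm 'I_k}, forall i j,
    (i != j) && (enorm (row (s i) X - row (s j) X) <= r) = Gamma i j.
Proof.
split=> [[phi [[phi_in phi_injT _] phiE]]|[dX [s sE]]]; last first.
  exists (fun i => row (s i) X); split; last first.
    move=> i j; rewrite -sE /geometric_edge/=; congr (~~ _ && _).
    by apply/eqP/eqP => [/dX /perm_inj //|->].
  split; first by move=> i _; exists (s i).
    by move=> i j _ _ /dX /perm_inj.
  by move=> _ [i _ <-]; exists (s^-1%g i) => //=; rewrite permKV.
have phi_inj : injective phi by move=> i j; apply: phi_injT; exact: mem_set.
have /choice[s sE] : forall i, exists j, row j X = phi i.
  by move=> i; have [j _ <-] := phi_in i Logic.I; exists j.
have s_inj : injective s.
  by move=> i j e; apply: phi_inj; rewrite -!sE e.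
have dX : distinct_rows X.
  have [t sK tK] := injF_bij s_inj.
  move=> i j /=; rewrite -(tK i) -(tK j) !sE => e; congr s.
  exact: phi_inj.
split => //; exists (perm s_inj) => i j; rewrite -phiE /geometric_edge/= !permE !sE.
by congr (~~ _ && _); apply/eqP/eqP => [-> //|]; exact: phi_inj.
Qed.

Lemma geometric_iso_recenter k (Gamma : rel 'I_k.+1) r X : 0 < r ->
  geometric_iso Gamma 1 (recenter r X) <-> geometric_iso Gamma r X.
Proof.
move=> r0; rewrite !geometric_isoP distinct_recenter//.
have E i j : (enorm (row i (recenter r X) - row j (recenter r X)) <= 1) =
             (enorm (row i X - row j X) <= r).
  by rewrite enorm_recenterB// ler_pdivrMr// mul1r.
by split=> -[dX [s sE]]; split => //; exists s => i j; rewrite -sE E.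
Qed.

Lemma measurable_near_rows k (i j : 'I_k) (r : R) :
  measurable [set X : 'M[R]_(k, d) | enorm (row i X - row j X) <= r].
Proof.
rewrite (_ : [set _ | _] = (fun X : 'M[R]_(k, d) => enorm (row i X - row j X)) @^-1`
  `]-oo, r]%classic); last by apply/seteqP; split => X /=; rewrite in_itv.
rewrite -[X in measurable X]setTI; apply: (measurableT_comp measurable_enorm) => //.
apply: measurable_to_mx => a b; under eq_fun do rewrite !mxE.
by apply: measurable_funB; exact: measurable_mx_entry.
Qed.

Lemma measurable_geometric_iso k (Gamma : rel 'I_k) r :
  measurable [set X : 'M[R]_(k, d) | geometric_iso Gamma r X].
Proof.
rewrite (_ : [set _ | _] = @distinct_rows R d k `&`
  \bigcup_(s in [set: {perm 'I_k}]) \bigcap_(ij in [set: 'I_k * 'I_k])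
   [set X : 'M[R]_(k, d) | (ij.1 != ij.2) &&
     (enorm (row (s ij.1) X - row (s ij.2) X) <= r) = Gamma ij.1 ij.2]).
  apply: measurableI; first exact: measurable_distinct_rows.
  apply: fin_bigcup_measurable => [|s _]; first exact: finite_finset.
  apply: fin_bigcap_measurable => // -[i j] _ /=.
  have mE := measurable_near_rows (s i) (s j) r.
  have [_|_] := eqVneq i j; case: (Gamma i j) => //=.
  - by rewrite [X in measurable X](_ : _ = set0)//; apply/seteqP; split.
  - by rewrite [X in measurable X](_ : _ = setT)//; apply/seteqP; split.
  rewrite [X in measurable X](_ : _ =
    ~` [set X : 'M[R]_(k, d) | enorm (row (s i) X - row (s j) X) <= r]).
    exact: measurableC.
  by apply/seteqP; split => X /=; [move=> ->|move/negP/negbTE].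
apply/seteqP; split => [X /geometric_isoP[dX [s sE]]|X [dX [s _ sE]]].
  by split => //; exists s => // -[i j] _ /=; exact: sE.
by apply/geometric_isoP; split => //; exists s => i j; exact: (sE (i, j)).
Qed.

Lemma measurable_rooted_tuples k : measurable (@rooted_tuples R d k).
Proof.
rewrite (_ : rooted_tuples = [set y : 'M[R]_(k.+1, d) | row ord0 y = 0] `&`
   ball_power `&` @distinct_rows R d k.+1); last first.
  by apply/seteqP; split=> [y []|y [[]]].
apply: measurableI; last exact: measurable_distinct_rows.
apply: measurableI.
  rewrite -[X in measurable X]setTI.
  exact: (measurable_row ord0 measurableT (measurable_mx1 (0 : 'rV[R]_d))).
rewrite (_ : ball_power = \bigcap_(i in [set: 'I_k.+1])
   ((fun y : 'M[R]_(k.+1, d) => enorm (row i y)) @^-1` `]-oo, k.+1%:R]%classic)).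
  apply: fin_bigcap_measurable => // i _; rewrite -[X in measurable X]setTI.
  exact: (measurableT_comp measurable_enorm (measurable_row i)).
apply/seteqP; split => [y By i _|y By i] /=.
  by rewrite in_itv/=; have := By i; rewrite /eball/= subr0.
by have := By i Logic.I; rewrite /= in_itv/= /eball/= subr0.
Qed.

(** A path without repeated vertices has at most k edges, each of length at
    most r. *)
Lemma connected_ball k (Gamma : rel 'I_k.+1) (X : 'M[R]_(k.+1, d)) r i j :
  connected_graph Gamma -> 0 <= r -> geometric_iso Gamma r X ->
  enorm (row i X - row j X) <= k%:R * r.
Proof.
move=> [_ _ conn] r0 /geometric_isoP[_ [s sE]].
rewrite -(permKV s i) -(permKV s j).
have /connectP[p0 + ->] := conn (s^-1%g j) (s^-1%g i).
case/shortenP => p pp up _ {p0}.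
have : (size p <= k)%N.
  by have := uniq_leq_size up (fun x _ => mem_enum 'I_k.+1 x); rewrite size_enum_ord.
rewrite -(ler_nat R) => /(ler_wpM2r r0); apply: le_trans.
move: {up} (s^-1%g j) pp; elim: p => [|b p IHp] a /=.
  by rewrite subrr enorm0 mul0r.
case/andP; rewrite -sE => /andP[_ ab] pp.
rewrite (_ : _ - _ = (row (s (last b p)) X - row (s b) X) + (row (s b) X - row (s a) X)).
  apply: le_trans (enormD _ _) _; rewrite -natr1 mulrDl mul1r lerD//; first exact: IHp.
  by rewrite -opprB enormN.
by rewrite addrA subrK.
Qed.

(** Connectedness confines the shapes that contribute to a compact set, where
    the scaling assumptions on the joint intensity apply. *)
Lemma geometric_iso_rooted k (Gamma : rel 'I_k.+1) (y : 'M[R]_(k, d)) :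
  connected_graph Gamma -> geometric_iso Gamma 1 (with_origin y) ->
  rooted_tuples (with_origin y).
Proof.
move=> conn iso; have row0 : row ord0 (with_origin y) = 0.
  by apply/rowP => j; rewrite [LHS]mxE with_origin0 mxE.
split => //; last by have /geometric_isoP[] := iso.
move=> i; rewrite /eball/= -row0; apply: le_trans (connected_ball _ _ conn ler01 iso) _.
by rewrite mulr1 ler_nat.
Qed.

Lemma rooted_cube k (y : 'M[R]_(k, d)) :
  rooted_tuples (with_origin y) -> mx_cube k.+1%:R y.
Proof.
move=> [_ By _]; apply/mx_cubeP => i j.
have := By (lift ord0 i); rewrite /eball/= subr0; apply: le_trans.
by apply: le_trans (le_coord_enorm _ j); rewrite [X in _ <= `|X|]mxE with_originS.
Qed.

End rooted_configurations.

(** * Roots that keep a configuration in the window *)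

Section window_room.
Context {R : realType} {d m : nat}.
Hypothesis d_gt0 : (0 < d)%N.
Implicit Types (y : 'M[R]_(m, d)) (r : R).

Local Notation side n := (n%:R `^ d%:R^-1 : R).

Lemma window_side_expn n : side n ^+ d = n%:R.
Proof.
rewrite -powR_mulrn ?powR_ge0// -powRrM mulVf ?powRr1//.
by rewrite pnatr_eq0 -lt0n.
Qed.

Lemma window_side_ge1 n : (0 < n)%N -> 1 <= side n.
Proof.
move=> n0; apply: (@le_trans _ _ (1 `^ (d%:R^-1) : R)); first by rewrite powR1.
by apply: ge0_ler_powR; rewrite ?nnegrE ?ler1n ?invr_ge0.
Qed.

Lemma lebesgue_window n : lebesgue_mx (@window R d n) = n%:R%:E.
Proof.
rewrite windowE lebesgue_mx_cube; last by rewrite divr_ge0// powR_ge0.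
by rewrite mul1n mulrCA divff// mulr1 window_side_expn.
Qed.

(** The volume of the roots for which the whole configuration of shape y lies
    in the window. *)
Definition root_room n r y : \bar R :=
  lebesgue_mx [set x | tuples_in (window n) (place r (x, y))].

Lemma measurable_tuples_in_window k n :
  measurable (tuples_in (window n) : set 'M[R]_(k, d)).
Proof.
exact: (measurable_row_box (B := fun=> window n) (fun=> measurable_window n)).
Qed.

Let mroom n r : measurable (place r @^-1` tuples_in (window n) :
  set ('rV[R]_d * 'M[R]_(m, d))).
Proof.
rewrite -[X in measurable X]setTI; apply: measurable_place => //.
exact: measurable_tuples_in_window.
Qed.

Lemma root_roomE n r y :
  [set x | tuples_in (window n) (place r (x, y))] =
  ysection (place r @^-1` tuples_in (window n)) y.
Proof. by apply/seteqP; split => x; [exact: mem_set|exact: set_mem]. Qed.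

Lemma measurable_root_room_set n r y :
  measurable [set x | tuples_in (window n) (place r (x, y))].
Proof. by rewrite root_roomE; exact: measurable_ysection. Qed.

Lemma measurable_root_room n r : measurable_fun setT (root_room n r).
Proof.
rewrite (_ : root_room n r =
    @lebesgue_mx R 1 d \o ysection (place r @^-1` tuples_in (window n))).
  exact: measurable_fun_ysection.
by apply/funext => y; rewrite /root_room root_roomE.
Qed.

(** The root itself is one of the points and has to be in the window. *)
Lemma root_room_le n r y : (root_room n r y <= n%:R%:E)%E.
Proof.
rewrite -lebesgue_window; apply: le_measure.
- exact: mem_set (measurable_root_room_set n r y).
- exact: mem_set (@measurable_window R d n).
- move=> x /(_ ord0) Wx j; have := Wx j; rewrite mxE placeE with_origin0.
  by rewrite mulr0 addr0.
Qed.

Lemma root_room_ge0 n r y : (0 <= root_room n r y)%E.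
Proof. exact: measure_ge0. Qed.

Lemma root_room_fin n r y : root_room n r y \is a fin_num.
Proof.
rewrite ge0_fin_numE ?root_room_ge0//.
exact: le_lt_trans (root_room_le n r y) (ltry _).
Qed.

Definition room_fraction n r y : R := fine (root_room n r y) / n%:R.

Lemma room_fraction_ge0 n r y : 0 <= room_fraction n r y.
Proof. by rewrite divr_ge0// fine_ge0// root_room_ge0. Qed.

Lemma room_fraction_le1 n r y : room_fraction n r y <= 1.
Proof.
rewrite /room_fraction; have [->|n0] := posnP n; first by rewrite invr0 mulr0.
rewrite ler_pdivrMr ?ltr0n// mul1r -lee_fin fineK ?root_room_fin//.
exact: root_room_le.
Qed.

(** All roots at sup-distance at least r * N from the complement of the window
    are admissible; the side of the window is at least 1. *)
Lemma room_fraction_ge n r N y : (0 < n)%N -> 0 <= r -> 0 <= N ->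
  2 * (r * N) <= 1 -> mx_cube N y -> (1 - 2 * (r * N)) ^+ d <= room_fraction n r y.
Proof.
move=> n0 r0 N0 rN /mx_cubeP yN; have L1 := window_side_ge1 n0.
have L0 : 0 < side n by exact: lt_le_trans L1.
rewrite ler_pdivlMr ?ltr0n// -lee_fin fineK ?root_room_fin//.
rewrite -[in leLHS](window_side_expn n) -exprMn.
have c0 : 0 <= side n / 2 - r * N by move: L1 rN; lra.
apply: (@le_trans _ _ (lebesgue_mx (@mx_cube R 1 d (side n / 2 - r * N)))).
  rewrite lebesgue_mx_cube// mul1n lee_fin; apply: lerXn2r; rewrite ?nnegrE.
  - by rewrite mulr_ge0 ?(ltW L0)// subr_ge0.
  - by rewrite mulr_ge0.
  - have rN0 : 0 <= r * N by exact: mulr_ge0.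
    have : r * N <= side n * (r * N) by rewrite ler_peMl.
    by lra.
apply: (@le_measure _ R _ (@lebesgue_mx R 1 d)).
- exact: mem_set (@measurable_cube R 1 d _).
- exact: mem_set (measurable_root_room_set n r y).
- move=> x /mx_cubeP xN i j; rewrite /= mxE placeE.
  apply: le_trans (ler_normD _ _) _.
  rewrite -[leRHS](subrK (r * N)) lerD//.
  rewrite normrM (ger0_norm r0) ler_wpM2l//.
  by case: (unliftP ord0 i) => [i'|] ->; rewrite ?with_originS ?with_origin0 ?normr0.
Qed.

(** Boundary effects vanish: by [room_fraction_ge] they concern a layer of
    relative width of order r_n. *)
Lemma room_fraction_cvg (r : nat -> R) y : (forall n, 0 < r n) ->
  r n @[n --> \oo] --> 0 -> room_fraction n (r n) y @[n --> \oo] --> (1 : R).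
Proof.
move=> r0 rcvg.
have [N _ yN] : (\bigcup_N @mx_cube R m d N%:R) y by rewrite mx_cube_cover.
have scvg : (1 - 2 * (r n * N%:R)) ^+ d @[n --> \oo] --> ((1 - 2 * (0 * N%:R)) ^+ d : R).
  apply: (cvg_comp _ (fun x : R => x ^+ d)); last exact: exprn_continuous.
  apply: cvgB; first exact: cvg_cst.
  apply: cvgM; first exact: cvg_cst.
  by apply: cvgM => //; exact: cvg_cst.
rewrite mul0r mulr0 subr0 expr1n in scvg.
apply: (squeeze_cvgr (f := fun n => (1 - 2 * (r n * N%:R)) ^+ d) (h := cst 1) _ scvg);
  last exact: cvg_cst.
have N0 : 0 < (2 * N.+1%:R)^-1 :> R by rewrite invr_gt0 mulr_gt0.
near=> n; apply/andP; split; last exact: room_fraction_le1.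
apply: room_fraction_ge => //; first by near: n; exists 1%N.
- exact: ltW.
- have : r n <= (2 * N.+1%:R)^-1.
    near: n; have /cvgrPdist_le/(_ _ N0) := rcvg; apply: filterS => n.
    by rewrite sub0r normrN; exact/le_trans/ler_norm.
  rewrite -[X in _ <= X]mul1r ler_pdivlMr ?mulr_gt0//.
  rewrite mulrCA; apply: le_trans; rewrite ler_pM2l// ler_pM2l//.
  by rewrite ler_nat.
Unshelve. all: by end_near. Qed.

End window_room.

(** * The mean number of configurations with a given shape *)

Section mean_counts.
Context {R : realType} {d : nat} {disp : measure_display}.
Context {T : measurableType disp} (P : probability T R).
Variable Phi : T -> set 'rV[R]_d.
Variable m : nat.
Variable rho : 'M[R]_(m.+1, d) -> R.
Hypothesis rho_intensity : joint_intensity P Phi rho.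
Hypothesis rho_inv : translation_invariant rho.
Variable S : set 'M[R]_(m.+1, d).
Hypothesis mS : measurable S.

Definition shape_count n r w : \bar R :=
  counting (distinct_tuples (Phi w `&` window n) `&` recenter r @^-1` S).

Let mrS r : measurable (recenter r @^-1` S).
Proof. by rewrite -[X in measurable X]setTI; exact: measurable_recenter. Qed.

(** The Campbell formula in root and shape coordinates. By translation
    invariance the joint intensity does not see the root, which is therefore
    integrated out and contributes the volume of the admissible roots. *)
Lemma mean_shape_count n r : 0 < r ->
  (\int[P]_w shape_count n r w = (r ^+ (m * d))%:E *
   \int[@lebesgue_mx R m d]_y
     ((\1_S (with_origin y) * rho (r *: with_origin y))%:E * root_room n r y))%E.
Proof.
move=> r0; have [mrho rho0 rhoE] := rho_intensity.
pose A := tuples_in (window n) `&` recenter r @^-1` S : set 'M[R]_(m.+1, d).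
have mA : measurable A by apply: measurableI => //; exact: measurable_tuples_in_window.
transitivity (intensity_measure P Phi A).
  apply: eq_integral => w _; congr counting.
  apply/seteqP; split => X.
    by move=> [[FX dX] SX]; split; [split => // i|split => // i]; have [] := FX i.
  by move=> [[FX dX] [WX SX]]; split => //; split => // i.
rewrite rhoE// integral_mkcond.
have mF : measurable_fun setT ((fun X => (rho X)%:E) \_ A).
  apply/(measurable_restrictT _ mA).
  by apply: measurable_funTS; exact/measurable_EFinP.
rewrite (ge0_integral_place r0 mF); last first.
  by move=> X; apply: erestrict_ge0 => Y _; rewrite lee_fin.
congr (_ * _)%E; apply: eq_integral => y _.
pose E := [set x | tuples_in (window n) (place r (x, y))].
have c0 : 0 <= \1_S (with_origin y) * rho (r *: with_origin y) by rewrite mulr_ge0.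
transitivity (\int[lebesgue_mx]_x
   ((\1_S (with_origin y) * rho (r *: with_origin y))%:E * (\1_E x)%:E))%E.
  apply: eq_integral => x _; rewrite patchE.
  have rhoP : rho (place r (x, y)) = rho (r *: with_origin y).
    rewrite -(rho_inv x (r *: with_origin y)); congr rho.
    apply/matrixP => i j.
    by rewrite placeE [RHS]mxE [X in _ = X + _]mxE [X in _ = _ + X]mxE addrC.
  have AE : A (place r (x, y)) <-> E x /\ S (with_origin y).
    by rewrite /A/= recenter_place// gt_eqF.
  rewrite -EFinM !indicE rhoP; case: ifPn => [/set_mem/AE[Ex Sy]|/negP nA].
    by rewrite (mem_set Ex) (mem_set Sy) mul1r mulr1.
  case: (boolP (x \in E)) => [/set_mem Ex|_]; last by rewrite mulr0.
  case: (boolP (_ \in S)) => [/set_mem Sy|_]; last by rewrite !mul0r.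
  by exfalso; apply: nA; apply/mem_set/AE.
have mE : measurable E by exact: measurable_root_room_set.
rewrite ge0_integralZl_EFin//.
- by rewrite integral_indic// setIT.
- exact/measurable_EFinP/measurable_indic.
Qed.

End mean_counts.

(** * Dominated convergence of the rescaled integrals *)

Lemma cvg_seq_at_right {R : realType} (r : nat -> R) : (forall n, 0 < r n) ->
  r n @[n --> \oo] --> 0 -> r n @[n --> \oo] --> (0 : R)^'+.
Proof.
move=> r0 rcvg A At0.
have : \forall n \near \oo, 0 < r n -> A (r n) := rcvg _ At0.
by apply: filterS => n; exact.
Qed.

Section dominated_scaling.
Context {R : realType} {d m : nat}.
Hypothesis d_gt0 : (0 < d)%N.
Variables (rho : 'M[R]_(m.+1, d) -> R) (S : set 'M[R]_(m.+1, d)).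
Hypotheses (mrho : measurable_fun setT rho) (rho0 : forall X, 0 <= rho X).
Hypothesis mS : measurable S.
Hypothesis S_rooted : forall y, S (with_origin y) -> rooted_tuples (with_origin y).
Variables (f : R -> R) (C : R).
Hypothesis f0 : forall s, 0 <= s -> 0 <= f s.
Hypothesis rho_le : \forall s \near 0^'+, forall Y, rooted_tuples Y ->
  rho (s *: Y) <= C * f s.
Variable r : nat -> R.
Hypotheses (r0 : forall n, 0 < r n) (rcvg : r n @[n --> \oo] --> 0).

Let mindic : measurable_fun setT (fun y : 'M[R]_(m, d) => \1_S (with_origin y) : R).
Proof.
have m1S : measurable_fun setT (\1_S : _ -> R) by exact: measurable_indic.
exact: (measurableT_comp m1S measurable_with_origin).
Qed.

Let mscaled n : measurable_fun setT
  (fun y : 'M[R]_(m, d) => rho (r n *: with_origin y)).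
Proof.
apply: measurableT_comp => //; apply: measurable_to_mx => i j.
under eq_fun do rewrite mxE; apply: measurable_funM => //.
exact: (measurableT_comp (measurable_mx_entry i j) measurable_with_origin).
Qed.

(** The integrand of [mean_shape_count] divided by n * f (r n), arranged as a
    product of a bounded ratio and a fraction in [0, 1]. *)
Definition scaled_integrand n (y : 'M[R]_(m, d)) : R :=
  \1_S (with_origin y) * (rho (r n *: with_origin y) / f (r n)) *
  room_fraction n (r n) y.

Lemma measurable_scaled_integrand n : measurable_fun setT (scaled_integrand n).
Proof.
apply: measurable_funM.
  by apply: measurable_funM => //; apply: measurable_funM.
apply: measurable_funM => //.
by apply: measurableT_comp => //; exact: measurable_root_room.
Qed.

Lemma scaled_integrand_ge0 n y : 0 <= scaled_integrand n y.
Proof.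
rewrite mulr_ge0 ?room_fraction_ge0// mulr_ge0// divr_ge0//.
by apply: f0; exact: ltW.
Qed.

(** If n or f (r n) vanishes, both sides are 0, the inverse of 0 being 0. *)
Lemma integral_scaled_integrand n :
  (\int[lebesgue_mx]_y (scaled_integrand n y)%:E =
   \int[lebesgue_mx]_y ((\1_S (with_origin y) * rho (r n *: with_origin y))%:E *
     root_room n (r n) y) * ((n%:R * f (r n))^-1)%:E)%E.
Proof.
rewrite -ge0_integralZr//=.
- apply: eq_integral => y _.
  rewrite -[in RHS](fineK (root_room_fin d_gt0 n (r n) y)) -!EFinM.
  congr EFin; rewrite /scaled_integrand /room_fraction invfM; ring.
- apply: emeasurable_funM; last exact: measurable_root_room.
  by apply/measurable_EFinP; exact: measurable_funM.
- by move=> y _; rewrite mule_ge0 ?measure_ge0// lee_fin mulr_ge0.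
- by rewrite lee_fin invr_ge0 mulr_ge0// f0// ltW.
Qed.

(** Where f (r n) = 0 the ratio is 0 by convention; elsewhere the uniform upper
    constant of the scaling assumption bounds it. *)
Lemma scaled_integrand_le : \forall n \near \oo, forall y,
  scaled_integrand n y <= `|C| * \1_(mx_cube m.+1%:R) y.
Proof.
have : \forall n \near \oo, forall Y, rooted_tuples Y ->
    rho (r n *: Y) <= C * f (r n) := cvg_seq_at_right r0 rcvg rho_le.
apply: filterS => n rhoC y; rewrite /scaled_integrand !indicE.
case: (boolP (with_origin y \in S)) => [/set_mem /S_rooted Ry|_]; last first.
  by rewrite !mul0r mulr_ge0.
rewrite (mem_set (rooted_cube Ry)) mulr1 mul1r.
apply: (@le_trans _ _ (rho (r n *: with_origin y) / f (r n))).
  rewrite ler_piMr ?room_fraction_le1// divr_ge0// f0// ltW//.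
have : 0 <= f (r n) by rewrite f0// ltW.
rewrite le_eqVlt => /predU1P[<-|fr]; first by rewrite invr0 mulr0.
rewrite ler_pdivrMr//; apply: le_trans (rhoC _ Ry) _.
by rewrite ler_wpM2r ?ler_norm// ltW.
Qed.

Let bound (y : 'M[R]_(m, d)) : \bar R := (`|C| * \1_(mx_cube m.+1%:R) y)%:E.

Let bound_integrable : (@lebesgue_mx R m d).-integrable setT bound.
Proof.
have mc : measurable (@mx_cube R m d m.+1%:R) by exact: measurable_cube.
apply/integrableP; split.
  by apply/measurable_EFinP; apply: measurable_funM => //; exact: measurable_indic.
rewrite (eq_integral (fun y => `|C|%:E * (\1_(mx_cube m.+1%:R) y)%:E)%E); last first.
  by move=> y _; rewrite /bound gee0_abs ?EFinM// lee_fin mulr_ge0.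
rewrite ge0_integralZl_EFin//; last exact/measurable_EFinP/measurable_indic.
rewrite integral_indic// setIT; have /= -> := @lebesgue_mx_cube R m d _ (ler0n R m.+1).
by rewrite -EFinM ltry.
Qed.

(** The domination only holds from some rank N on, so the dominated convergence
    theorem is applied to the sequence shifted by N. The limit is measurable as
    a pointwise limit. *)
Lemma cvg_scaled_integral (g : 'M[R]_(m.+1, d) -> R) :
  (forall Y, rooted_tuples Y -> rho (s *: Y) / f s @[s --> 0^'+] --> g Y) ->
  let l := (\int[lebesgue_mx]_y (\1_S (with_origin y) * g (with_origin y))%:E)%E in
  l \is a fin_num /\
  (\int[lebesgue_mx]_y (scaled_integrand n y)%:E)%E @[n --> \oo] --> l.
Proof.
move=> rho_g l.
have ptwise y : scaled_integrand n y @[n --> \oo] -->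
    \1_S (with_origin y) * g (with_origin y).
  rewrite -[X in _ --> X]mulr1; apply: cvgM; last exact: room_fraction_cvg.
  rewrite /= indicE; case: (boolP (with_origin y \in S)) => [/set_mem /S_rooted Ry|_].
    apply: cvgM; first exact: cvg_cst.
    exact: (cvg_comp _ _ (cvg_seq_at_right r0 rcvg) (rho_g _ Ry)).
  rewrite mul0r; apply: cvg_near_cst; apply: nearW => n; rewrite mul0r//.
have [N _ bnd] := scaled_integrand_le.
have := @dominated_convergence _ _ _ (@lebesgue_mx R m d) setT measurableT
  (fun n y => (scaled_integrand (n + N) y)%:E)
  (fun y => (\1_S (with_origin y) * g (with_origin y))%:E) bound.
case.
- by move=> n; apply/measurable_EFinP; exact: measurable_scaled_integrand.
- apply: (@emeasurable_fun_cvg _ _ _ _ (fun n y => (scaled_integrand n y)%:E)).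
  + by move=> n; apply/measurable_EFinP; exact: measurable_scaled_integrand.
  + by move=> y _; apply: cvg_EFin; [exact: nearW|exact: ptwise].
- apply: aeW => y _; apply: cvg_EFin; first exact: nearW.
  by rewrite (cvg_shiftn N (fun n => scaled_integrand n y)).
- exact: bound_integrable.
- apply: aeW => y n _; rewrite gee0_abs ?lee_fin ?scaled_integrand_ge0//.
  by apply: bnd; rewrite /= leq_addl.
move=> il _; rewrite (cvg_shiftn N (fun n => \int[_]_y (scaled_integrand n y)%:E)%E).
by move=> cvl; split => //; exact: integrable_fin_num.
Qed.

End dominated_scaling.

(** * Comparing counts *)

Section counting_comparison.
Context {R : realType}.

Lemma counting_ge0 (T : choiceType) (A : set T) : (0 <= counting A :> \bar R)%E.
Proof. by rewrite /counting; case: ifPn; rewrite ?lee_fin ?leey. Qed.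

Lemma counting_fsum (T : choiceType) (D A : set T) : finite_set D ->
  counting (D `&` A) = (\sum_(x \in D) (`[<A x>]%:R : R))%:E :> \bar R.
Proof.
move=> /finite_seqP[s0 ->].
have -> : [set` s0] = [set` undup s0].
  by apply/seteqP; split => x /=; rewrite mem_undup.
by rewrite counting_seq ?undup_uniq// -fsbig_seq ?undup_uniq.
Qed.

Lemma le_counting (T : choiceType) (A B : set T) : finite_set B -> A `<=` B ->
  (counting A <= counting B :> \bar R)%E.
Proof.
move=> fB AB; have fA := sub_finite_set AB fB.
rewrite /counting !asboolT// lee_fin ler_nat; apply: fsubset_leq_card.
by apply/fsubsetP => x; rewrite !in_fset_set// !inE; exact: AB.
Qed.

(** A surjection from a subset of B suffices to bound a count: extensions of
    tuples are compared with tuples by forgetting the added point, without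
    choosing an extension. *)
Lemma le_counting_image (T U : choiceType) (g : U -> T) (A : set T) (B : set U) :
  finite_set B -> A `<=` g @` B -> (counting A <= counting B :> \bar R)%E.
Proof.
move=> fB AgB; have fgB : finite_set (g @` B) by exact: finite_image.
apply: le_trans (le_counting fgB AgB) _.
rewrite /counting !asboolT// lee_fin ler_nat fset_set_image//.
exact: leq_imfset_card.
Qed.

Lemma counting_range_rows d k (X : 'M[R]_(k, d)) : distinct_rows X ->
  counting (range (fun i => row i X)) = k%:R%:E :> \bar R.
Proof.
move=> dX; have -> : range (fun i => row i X) =
    [set` [seq row i X | i <- enum 'I_k]] `&` setT.
  rewrite setIT; apply/seteqP; split => [_ [i _ <-]|x /= /mapP[i _ ->]]; last by exists i.
  by apply/mapP; exists i; rewrite ?mem_enum.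
rewrite counting_seq; last by rewrite map_inj_uniq ?enum_uniq.
rewrite big_map (eq_bigr (fun=> 1)); last by move=> i _; rewrite asboolT.
by rewrite big_const_seq count_predT size_enum_ord iter_addr_0.
Qed.

End counting_comparison.

(** * Copies of the graph that are not isolated *)

Section isolated_or_extended.
Context {R : realType} {d m : nat}.
Variables (F : set 'rV[R]_d) (Gamma : rel 'I_m.+1) (r : R).
Hypotheses (finF : finite_set F) (r0 : 0 < r).
Hypothesis Gamma_conn : connected_graph Gamma.

Definition isolated_in : set 'M[R]_(m.+1, d) :=
  [set X | counting (F `&` eball_union X r) = m.+1%:R%:E :> \bar R].

Lemma finite_distinct_tuples k : finite_set (distinct_tuples F : set 'M[R]_(k, d)).
Proof. by apply: sub_finite_set (finite_tuples_in k finF) => X []. Qed.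

(** If the points near the copy are not exactly its m + 1 vertices, some z
    among them is not a vertex. Put in front, z becomes the root of a tuple of
    m + 2 distinct points; its other points are within m * r + r of z. *)
Lemma extend_not_isolated : distinct_tuples F `&`
    [set X | geometric_iso Gamma r X] `&` ~` isolated_in `<=`
  (row' ord0 : 'M[R]_(m.+2, d) -> 'M[R]_(m.+1, d)) @`
    (distinct_tuples F `&` recenter r @^-1` rooted_tuples).
Proof.
move=> X [[[FX dX] isoX] nX].
have [z [[Fz [i0 _ zX]] Xz]] : exists z,
    (F `&` eball_union X r) z /\ forall i, row i X <> z.
  apply: contrapT => nz; apply: nX; rewrite /isolated_in/= -(counting_range_rows dX).
  congr counting; apply/seteqP; split => [z Fz|_ [i _ <-]].
    apply: contrapT => zX; apply: nz; exists z; split => // i Xz.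
    by apply: zX; exists i.
  split; first exact: FX.
  by exists i => //; rewrite /eball/= subrr enorm0 ltW.
pose Y : 'M[R]_(m.+2, d) :=
  \matrix_(i, j) if unlift ord0 i is Some i' then X i' j else z 0 j.
have Y0 : row ord0 Y = z by apply/rowP => j; rewrite !mxE unlift_none.
have YS i : row (lift ord0 i) Y = row i X.
  by apply/rowP => j; rewrite !mxE liftK.
have dY : distinct_rows Y.
  move=> i j /=; case: (unliftP ord0 i) => [i'|] ->; case: (unliftP ord0 j) => [j'|] ->;
    rewrite ?Y0 ?YS => //.
  - by move=> /dX ->.
  - by move=> /Xz.
  - by move=> /esym /Xz.
exists Y; last by apply/matrixP => i j; rewrite mxE [LHS]mxE liftK.
split.
  split=> // i; case: (unliftP ord0 i) => [i'|] ->; rewrite ?Y0 ?YS//; exact: FX.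
split; last exact/distinct_recenter.
  by apply/rowP => j; rewrite !mxE subrr mulr0.
have row0 : row ord0 (recenter r Y) = 0.
  by apply/rowP => j; rewrite !mxE subrr mulr0.
move=> i; rewrite /eball/= -row0 enorm_recenterB// ler_pdivrMr//.
case: (unliftP ord0 i) => [i'|] ->; last by rewrite subrr enorm0 mulr_ge0// ltW.
rewrite YS Y0 (_ : _ - z = (row i' X - row i0 X) + (row i0 X - z)); last first.
  by rewrite addrA subrK.
apply: le_trans (enormD _ _) _.
have := connected_ball i' i0 Gamma_conn (ltW r0) isoX.
have : enorm (row i0 X - z) <= r by rewrite -opprB enormN.
rewrite -!natr1 => h1 h2; move: r0 => r0'; lra.
Qed.

(** Every copy is isolated or arises by deleting the root of a rooted tuple
    with one more point. *)
Lemma counting_iso_le :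
  (counting (distinct_tuples F `&` [set X | geometric_iso Gamma r X]) <=
   counting (distinct_tuples F `&` ([set X | geometric_iso Gamma r X] `&` isolated_in)) +
   counting (distinct_tuples F `&`
     recenter r @^-1` (rooted_tuples : set 'M[R]_(m.+2, d))) :> \bar R)%E.
Proof.
have fD k := finite_distinct_tuples k.
set A := [set X | geometric_iso Gamma r X].
have fDA (B : set 'M[R]_(m.+1, d)) : finite_set (distinct_tuples F `&` B).
  by apply: sub_finite_set (fD _); exact: subIsetl.
have -> : distinct_tuples F `&` A =
    (distinct_tuples F `&` (A `&` isolated_in)) `|`
    (distinct_tuples F `&` A `&` ~` isolated_in).
  by rewrite setIA -setIUr setUv setIT.
rewrite measureU; last 3 first.
- exact: finite_measurable_mx.
- by rewrite -setIA; exact: finite_measurable_mx.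
- by rewrite setIA setIACA setICr setI0.
apply: leeD => //; apply: le_counting_image; last exact: extend_not_isolated.
by apply: sub_finite_set (fD _); exact: subIsetl.
Qed.

End isolated_or_extended.

(** * Integrals of functions of unknown measurability *)

Section lower_integral.
Local Open Scope ereal_scope.
Context d {T : measurableType d} {R : realType} (mu : {measure set T -> \bar R}).

(** The integral of a nonnegative function is the supremum of the integrals of
    the simple functions below it, and this is monotone for all functions. *)
Lemma le_integral_nonmeasurable (f g : T -> \bar R) :
  (forall x, 0 <= f x) -> (forall x, f x <= g x) ->
  \int[mu]_x f x <= \int[mu]_x g x.
Proof.
move=> f0 fg; have g0 x : 0 <= g x by exact: le_trans (fg x).
rewrite !ge0_integralTE//; apply: le_ereal_sup => _ [h hf <-].
by exists h => // x; exact: le_trans (fg x).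
Qed.

(** The positive part of f - h is measurable, lies below g, and together with
    h it dominates f. *)
Lemma le_integralD_nonmeasurable (f g h : T -> \bar R) :
  (forall x, 0 <= f x) -> (forall x, 0 <= g x) -> (forall x, 0 <= h x) ->
  measurable_fun setT f -> measurable_fun setT h ->
  (forall x, h x \is a fin_num) ->
  (forall x, f x <= g x + h x) ->
  \int[mu]_x f x <= \int[mu]_x g x + \int[mu]_x h x.
Proof.
move=> f0 g0 h0 mf mh hfin fgh.
pose e x := maxe (f x - h x) 0.
have e0 x : 0 <= e x by rewrite /e le_max lexx orbT.
have me : measurable_fun setT e.
  by apply: measurable_maxe => //; exact: emeasurable_funB.
apply: (@le_trans _ _ (\int[mu]_x (e x + h x))).
  apply: ge0_le_integral => //.
  - exact: emeasurable_funD.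
  - by move=> x _; rewrite -leeBlDr// /e le_max lexx.
rewrite ge0_integralD//; apply: leeD => //.
apply: le_integral_nonmeasurable => // x.
by rewrite /e ge_max g0 andbT leeBlDr.
Qed.

End lower_integral.

(** * Limits of the normalized mean counts *)

Section normalized_counts.
Context {R : realType} {d : nat} {disp : measure_display}.
Hypothesis d_gt0 : (0 < d)%N.
Context {T : measurableType disp} (P : probability T R).
Variable Phi : T -> set 'rV[R]_d.
Hypothesis Phi_pp : point_process Phi.
Variables (m : nat) (rho : 'M[R]_(m.+1, d) -> R) (rho' : 'M[R]_(m.+2, d) -> R).
Hypothesis rho_intensity : joint_intensity P Phi rho.
Hypothesis rho'_intensity : joint_intensity P Phi rho'.
Hypothesis rho_inv : translation_invariant rho.
Hypothesis rho'_inv : translation_invariant rho'.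
Variable Gamma : rel 'I_m.+1.
Hypothesis Gamma_conn : connected_graph Gamma.
Variable r : nat -> R.
Hypotheses (r0 : forall n, 0 < r n) (rcvg : r n @[n --> \oo] --> 0).

Let S : set 'M[R]_(m.+1, d) := [set X | geometric_iso Gamma 1 X].
Let S' : set 'M[R]_(m.+2, d) := rooted_tuples.
Let c : R := (m.+1)`!%:R^-1.
Let c0 : 0 <= c. Proof. by rewrite invr_ge0. Qed.
Let mS : measurable S. Proof. exact: measurable_geometric_iso. Qed.
Let mS' : measurable S'. Proof. exact: measurable_rooted_tuples. Qed.

Lemma recenter_shape n :
  recenter (r n) @^-1` S = [set X | geometric_iso Gamma (r n) X].
Proof. by apply/seteqP; split => X /=; rewrite /S/= geometric_iso_recenter. Qed.

Lemma subgraph_countE n w : (subgraph_count Phi r n Gamma w)%:E =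
  (c%:E * shape_count Phi S n (r n) w)%E.
Proof.
rewrite /shape_count recenter_shape counting_fsum; last first.
  exact/finite_distinct_tuples/finite_in_window.
by rewrite -EFinM.
Qed.

Lemma isolated_countE n w : (isolated_count Phi r n Gamma w)%:E =
  (c%:E * counting (distinct_tuples (Phi w `&` window n) `&`
     ([set X | geometric_iso Gamma (r n) X] `&`
      isolated_in (m := m) (Phi w `&` window n) (r n))))%E.
Proof.
rewrite counting_fsum; last exact/finite_distinct_tuples/finite_in_window.
rewrite -EFinM; congr (_ * _)%:E; apply: eq_fsbigr => X _.
by rewrite /h_graph -natrM mulnb -asbool_and.
Qed.

Lemma shape_count_ge0 k (A : set 'M[R]_(k.+1, d)) n s w :
  (0 <= shape_count Phi A n s w :> \bar R)%E.
Proof. exact: counting_ge0. Qed.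

Lemma measurable_shape_count k (A : set 'M[R]_(k.+1, d)) n s : measurable A ->
  measurable_fun setT (shape_count Phi A n s : T -> \bar R).
Proof.
move=> mA; apply: measurable_distinct_count => //.
by rewrite -[X in measurable X]setTI; exact: measurable_recenter.
Qed.

Lemma shape_count_fin k (A : set 'M[R]_(k.+1, d)) n s w :
  shape_count Phi A n s w \is a fin_num.
Proof.
rewrite /shape_count counting_fsum//.
exact/finite_distinct_tuples/finite_in_window.
Qed.

Lemma mean_subgraph_count n : ('E_P[subgraph_count Phi r n Gamma] =
  c%:E * \int[P]_w shape_count Phi S n (r n) w)%E.
Proof.
rewrite unlock; under eq_integral => w _ do rewrite subgraph_countE.
rewrite ge0_integralZl_EFin//; exact: measurable_shape_count.
Qed.

Lemma isolated_count_ge0 n w : 0 <= isolated_count Phi r n Gamma w.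
Proof.
rewrite /isolated_count mulr_ge0// fsumr_ge0// => X _.
by rewrite mulr_ge0// /h_graph.
Qed.

Lemma mean_isolated_count_le n : ('E_P[isolated_count Phi r n Gamma] <=
  'E_P[subgraph_count Phi r n Gamma])%E.
Proof.
rewrite unlock; apply: le_integral_nonmeasurable => w.
  by rewrite lee_fin isolated_count_ge0.
rewrite isolated_countE subgraph_countE lee_wpmul2l ?lee_fin//.
rewrite /shape_count recenter_shape; apply: le_counting.
  apply: (sub_finite_set (@subIsetl _ _ _)).
  exact/finite_distinct_tuples/finite_in_window.
by move=> X [DX [SX _]].
Qed.

(** What G counts and J does not is bounded by the number of rooted tuples with
    one more point. *)
Lemma mean_subgraph_count_le n : ('E_P[subgraph_count Phi r n Gamma] <=
  'E_P[isolated_count Phi r n Gamma] +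
  c%:E * \int[P]_w shape_count Phi S' n (r n) w)%E.
Proof.
rewrite -ge0_integralZl_EFin//; last exact: measurable_shape_count.
rewrite unlock; apply: le_integralD_nonmeasurable.
- by move=> w; rewrite subgraph_countE mule_ge0// shape_count_ge0.
- by move=> w; rewrite lee_fin isolated_count_ge0.
- by move=> w; rewrite mule_ge0// shape_count_ge0.
- under eq_fun => w do rewrite subgraph_countE.
  by apply: emeasurable_funM => //; exact: measurable_shape_count.
- by apply: emeasurable_funM => //; exact: measurable_shape_count.
- by move=> w; rewrite fin_numM// shape_count_fin.
move=> w; rewrite subgraph_countE isolated_countE.
rewrite -ge0_muleDr ?shape_count_ge0 ?counting_ge0//.
rewrite lee_wpmul2l ?lee_fin// /shape_count recenter_shape.
by apply: counting_iso_le => //; exact: finite_in_window.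
Qed.

Variables (f : R -> R) (C C1 : R).
Hypothesis f0 : forall s, 0 <= s -> 0 <= f s.
Hypothesis rho_le : \forall s \near 0^'+, forall Y, rooted_tuples Y ->
  rho (s *: Y) <= C * f s.
Hypothesis rho'_le : \forall s \near 0^'+, forall Y, rooted_tuples Y ->
  rho' (s *: Y) <= C1 * f s.

(** The power r ^ (m d) of the Campbell formula cancels against the
    normalization, and what remains is [cvg_scaled_integral]. *)
Lemma cvg_subgraph_count (g : 'M[R]_(m.+1, d) -> R) :
  (forall Y, rooted_tuples Y -> rho (s *: Y) / f s @[s --> 0^'+] --> g Y) ->
  let l := (\int[@lebesgue_mx R m d]_y
    (\1_S (with_origin y) * g (with_origin y))%:E)%E in
  l \is a fin_num /\
  normalized_limit P d m r f (fun n => subgraph_count Phi r n Gamma) (c%:E * l)%E.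
Proof.
move=> rho_g l; have [mrho rho0 _] := rho_intensity.
have S_rooted (y : 'M[R]_(m, d)) : S (with_origin y) -> rooted_tuples (with_origin y).
  exact: geometric_iso_rooted.
have [lfin lcvg] := cvg_scaled_integral d_gt0 mrho rho0 mS S_rooted f0 rho_le r0 rcvg rho_g.
split => //; rewrite /normalized_limit.
rewrite (_ : (fun n => _) = (fun n => c%:E *
    \int[@lebesgue_mx R m d]_y (scaled_integrand rho S f r n y)%:E)%E).
  by apply: cvgeZl.
apply/funext => n; rewrite mean_subgraph_count -muleA; congr (_ * _)%E.
rewrite (mean_shape_count rho_intensity rho_inv mS n (r0 n)).
rewrite integral_scaled_integrand// [LHS]muleAC muleC -EFinM; congr (_ * _%:E)%E.
have rn0 : r n ^+ (m * d) != 0 by rewrite expf_neq0// gt_eqF.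
by rewrite (mulnC d) mulrAC invfM mulrC mulfVK.
Qed.

Let K : R := (2 * m.+2%:R) ^+ (m.+1 * d).

(** Shapes of rooted tuples lie in a cube of side 2 (m + 2), and there are at
    most n units of volume of roots for each of them. *)
Lemma mean_extended_count_le n :
  (forall Y, rooted_tuples Y -> rho' (r n *: Y) <= C1 * f (r n)) ->
  (\int[P]_w shape_count Phi S' n (r n) w <=
  (r n ^+ (m.+1 * d) * (`|C1| * f (r n) * n%:R * K))%:E)%E.
Proof.
move=> rhoC; have [mrho rho0 _] := rho'_intensity.
have fr : 0 <= f (r n) by rewrite f0// ltW.
rewrite (mean_shape_count rho'_intensity rho'_inv mS' n (r0 n)) EFinM.
apply: lee_wpmul2l; first by rewrite lee_fin exprn_ge0// ltW.
have mc : measurable (@mx_cube R m.+1 d m.+2%:R) by exact: measurable_cube.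
have C1f : 0 <= `|C1| * f (r n) * n%:R by rewrite !mulr_ge0.
rewrite EFinM -(lebesgue_mx_cube m.+1 d (ler0n R m.+2)).
rewrite -[X in lebesgue_mx X]setIT -(integral_indic _ measurableT mc).
rewrite -ge0_integralZl_EFin//; last exact/measurable_EFinP/measurable_indic.
apply: le_integral_nonmeasurable => y.
  by rewrite mule_ge0 ?root_room_ge0// lee_fin mulr_ge0.
rewrite !indicE; case: (boolP (with_origin y \in S')) => [/set_mem Ry|_]; last first.
  by rewrite mul0r mul0e mule_ge0// lee_fin.
rewrite mul1r (mem_set (rooted_cube Ry)) mule1 EFinM.
apply: lee_pmul => //; rewrite ?lee_fin//.
  by apply: le_trans (rhoC _ Ry) _; rewrite ler_wpM2r// ler_norm.
exact: root_room_le.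
Qed.

(** One point more costs one more factor r ^ d. *)
Lemma extended_count_le : \forall n \near \oo,
  (\int[P]_w shape_count Phi S' n (r n) w *
    ((n%:R * r n ^+ (d * m) * f (r n))^-1)%:E <= (`|C1| * K * r n ^+ d)%:E)%E.
Proof.
have : \forall n \near \oo, forall Y, rooted_tuples Y ->
    rho' (r n *: Y) <= C1 * f (r n) := cvg_seq_at_right r0 rcvg rho'_le.
apply: filterS => n /mean_extended_count_le meanC.
have fr : 0 <= f (r n) by rewrite f0// ltW.
have rn : 0 <= r n by exact: ltW.
apply: (@le_trans _ _ ((r n ^+ (m.+1 * d) * (`|C1| * f (r n) * n%:R * K))%:E *
    ((n%:R * r n ^+ (d * m) * f (r n))^-1)%:E)%E).
  by rewrite lee_wpmul2r// lee_fin invr_ge0 !mulr_ge0// exprn_ge0.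
have K0 : 0 <= K by rewrite exprn_ge0// mulr_ge0.
(* When the normalization is 0, so is its inverse. *)
rewrite -EFinM lee_fin; have [nf|nf] := eqVneq (n%:R * f (r n)) 0.
  by rewrite [_ * f (r n)]mulrAC nf mul0r invr0 mulr0 !mulr_ge0// exprn_ge0.
rewrite mulSn exprD mulnC le_eqVlt; apply/orP; left; apply/eqP.
move: nf; rewrite mulf_eq0 negb_or => /andP[n0 f_neq0].
have rdm : r n ^+ (d * m) != 0 by rewrite expf_neq0// gt_eqF.
by field; rewrite n0 f_neq0 rdm.
Qed.

(** The means of G and J differ by a quantity that is negligible after
    normalization. *)
Lemma cvg_isolated_count (l : \bar R) : l \is a fin_num ->
  normalized_limit P d m r f (fun n => subgraph_count Phi r n Gamma) l ->
  normalized_limit P d m r f (fun n => isolated_count Phi r n Gamma) l.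
Proof.
rewrite /normalized_limit => lfin Gl.
pose beta n : R := c * (`|C1| * K * r n ^+ d).
have beta0 : (beta n)%:E @[n --> \oo] --> (0%:E : \bar R).
  apply: cvg_EFin; first exact: nearW.
  rewrite -(mulr0 c); apply: cvgM; first exact: cvg_cst.
  rewrite -(mulr0 (`|C1| * K)); apply: cvgM; first exact: cvg_cst.
  have := cvg_comp r (fun x : R => x ^+ d) rcvg (@exprn_continuous R d 0).
  by rewrite expr0n gtn_eqF.
have lower := cvgeB (fin_num_adde_defr _ lfin) Gl beta0.
rewrite sube0 in lower.
pose D n := ((n%:R * r n ^+ (d * m) * f (r n))^-1)%:E : \bar R.
apply: (squeeze_cvge
  (f := fun n => ('E_P[subgraph_count Phi r n Gamma] * D n - (beta n)%:E)%E)
  (h := fun n => ('E_P[subgraph_count Phi r n Gamma] * D n)%E)); [|exact: lower|exact: Gl].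
have := extended_count_le; apply: filterS => n extC.
have cn0 : (0 <= ((n%:R * r n ^+ (d * m) * f (r n))^-1)%:E)%E.
  by rewrite lee_fin invr_ge0 !mulr_ge0 ?exprn_ge0// ?f0// ltW.
apply/andP; split; last by apply: lee_wpmul2r => //; exact: mean_isolated_count_le.
rewrite leeBlDr//.
apply: le_trans (lee_wpmul2r cn0 (mean_subgraph_count_le n)) _.
rewrite ge0_muleDl; last 2 first.
- by rewrite unlock; apply: integral_ge0 => w _; rewrite lee_fin isolated_count_ge0.
- by rewrite mule_ge0 ?lee_fin//; apply: integral_ge0 => w _; exact: shape_count_ge0.
by rewrite leeD2l// -muleA /beta EFinM lee_wpmul2l// lee_fin.
Qed.

End normalized_counts.

(** * Graphs with one vertex *)

Section one_vertex.
Context {R : realType} {d : nat} {disp : measure_display}.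
Context {T : measurableType disp} (P : probability T R).
Variable Phi : T -> set 'rV[R]_d.

(** By translation invariance the intensity is a constant, which a cube shows
    to be 1. In particular the intensity cannot vanish at 0 when k = 1. *)
Lemma unit_intensity_density (rho : 'M[R]_(1, d) -> R) : unit_intensity P Phi ->
  joint_intensity P Phi rho -> translation_invariant rho -> rho 0 = 1.
Proof.
move=> Phi_unit [_ _ rhoE] rho_inv.
have rho_cst X : rho X = rho 0.
  rewrite -[RHS](rho_inv (X : 'rV[R]_d)) add0r; congr rho.
  by apply/rowP => j; rewrite mxE.
have mc : measurable (@mx_cube R 1 d 1) by exact: measurable_cube.
have := rhoE _ mc; rewrite Phi_unit// (eq_integral (fun=> (rho 0)%:E)); last first.
  by move=> X _; rewrite rho_cst.
rewrite integral_cst// lebesgue_mx_cube//; have /= -> := @lebesgue_mx_cube R 1 d _ ler01.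
rewrite -EFinM => -[e]; apply: (@mulIf _ ((2 * 1) ^+ (1 * d))).
  by rewrite expf_neq0// mulr1.
by rewrite mul1r -e.
Qed.

Lemma geometric_iso_one_vertex (Gamma : rel 'I_1) r (X : 'M[R]_(1, d)) :
  irreflexive Gamma -> geometric_iso Gamma r X.
Proof.
move=> irr; apply/geometric_isoP; split; first by move=> i j _; rewrite !ord1.
by exists 1%g => i j; rewrite !ord1 eqxx/= irr.
Qed.

Lemma lebesgue_mx0T : lebesgue_mx [set: 'M[R]_(0, d)] = 1%E.
Proof.
have := @lebesgue_mx_cube R 0 d 0 (lexx _); rewrite mul0n expr0 => <-.
by congr lebesgue_mx; apply/seteqP; split => // X _ [].
Qed.

End one_vertex.

(** * The scaling assumptions *)

(** Rooted tuples are bounded, so that s Y tends to 0 uniformly in Y. *)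
Lemma continuous_at0_scaling {R : realType} {d m : nat}
    (rho : 'M[R]_(m.+1, d) -> R) : {for 0, continuous rho} ->
  forall e : R, 0 < e ->
  \forall s \near (0 : R)^'+, forall Y, rooted_tuples Y -> `|rho 0 - rho (s *: Y)| < e.
Proof.
move=> crho e e0; have /cvgrPdist_lt/(_ _ e0) := crho.
move=> /nbhs_ballP[del /= del0 near_rho].
have dm0 : 0 < del / m.+2%:R by rewrite divr_gt0.
near=> s; move=> Y [_ BY _]; apply: near_rho.
have s0 : 0 < s by near: s; exact: nbhs_right_gt.
split=> [|i j]; first exact: del0.
rewrite /ball/= !mxE sub0r normrN normrM (gtr0_norm s0).
have Yij : `|Y i j| <= m.+1%:R.
  have := BY i; rewrite /eball/= subr0; apply: le_trans.
  by apply: le_trans (le_coord_enorm _ j); rewrite mxE.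
apply: (@le_lt_trans _ _ (s * m.+1%:R)); first by rewrite ler_wpM2l// ltW.
apply: (@lt_trans _ _ (s * m.+2%:R)); first by rewrite ltr_pM2l// ltr_nat.
rewrite -ltr_pdivlMr//; near: s; exact: nbhs_right_lt.
Unshelve. all: by end_near. Qed.

(** The bound for k + 1 points in terms of f^{k+1} passes to f^k. *)
Lemma dominated_scales_as {R : realType} {d m : nat}
    (rho : 'M[R]_(m.+1, d) -> R) (f f1 : R -> R) :
  (forall s, 0 <= s -> 0 <= f s) -> scales_as rho f1 ->
  (f1 : R -> R^o) =O_ (0^'+) (f : R -> R^o) ->
  exists C, \forall s \near 0^'+, forall Y, rooted_tuples Y ->
    rho (s *: Y) <= C * f s.
Proof.
move=> f0 [f10 _ [C rhoC]] /eqO_exP[M M0 f1f].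
exists (`|C| * M); near=> s => Y RY.
have s0 : 0 < s by near: s; exact: nbhs_right_gt.
have sC : forall Y, rooted_tuples Y -> rho (s *: Y) <= C * f1 s by near: s.
apply: le_trans (sC _ RY) _.
apply: le_trans (ler_norm _) _; rewrite normrM -mulrA ler_wpM2l//.
have : `|f1 s| <= M * `|f s| by near: s.
by rewrite (ger0_norm (f0 _ (ltW s0))).
Unshelve. all: by end_near. Qed.

(** * Subgraph counts in the sparse regime *)

(* k = m.+1 is the number of vertices of Gamma, f1 stands for f^{k+1}. *)
Theorem theorem3p1 (R : realType) (d : nat) (d_gt0 : (0 < d)%N)
    (disp : measure_display) (T : measurableType disp) (P : probability T R)
    (Phi : T -> set 'rV[R]_d)
    (Phi_pp : point_process Phi)
    (Phi_stat : stationary P Phi)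
    (Phi_unit : unit_intensity P Phi)
    (rho : forall k : nat, 'M[R]_(k, d) -> R)
    (rho_intensity : forall k, joint_intensity P Phi (rho k))
    (rho_inv : forall k, translation_invariant (rho k.+1))
    (m : nat) (Gamma : rel 'I_m.+1)
    (Gamma_conn : connected_graph Gamma)
    (Gamma_feasible : feasible Gamma (rho m.+1))
    (rho_cont : ae_continuous_on setT (rho m.+1))
    (r : nat -> R) (r_gt0 : forall n, 0 < r n)
    (r_cvg : r n @[n --> \oo] --> 0) :
  let claim (f : R -> R) (g : 'M[R]_(m.+1, d) -> R) :=
    normalized_limit P d m r f (fun n => subgraph_count Phi r n Gamma)
      (mu0 Gamma g) /\
    normalized_limit P d m r f (fun n => isolated_count Phi r n Gamma)
      (mu0 Gamma g) in
  (rho m.+1 0 = 0 ->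
   forall (f f1 : R -> R) (g : 'M[R]_(m.+1, d) -> R),
     scales_as (rho m.+1) f ->
     scaling_limit (rho m.+1) f g ->
     scales_as (rho m.+2) f1 ->
     (f1 : R -> R^o) =O_ (0^'+) (f : R -> R^o) ->
     ae_continuous_on ball_power g ->
     claim f g) /\
  (0 < rho m.+1 0 ->
   {for 0, continuous (rho m.+1)} ->
   forall f1 : R -> R,
     scales_as (rho m.+2) f1 ->
     (f1 : R -> R^o) =O_ (0^'+) ((fun=> 1) : R -> R^o) ->
     claim (fun=> 1) (fun=> rho m.+1 0)).
Proof.
move=> claim; have intensity k : joint_intensity P Phi (rho k.+1) by exact: rho_intensity.
have mu0E g : m != 0%N -> mu0 Gamma g = ((m.+1)`!%:R^-1%:E *
    \int[@lebesgue_mx R m d]_y (\1_[set X | geometric_iso Gamma 1 X] (with_origin y) *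
      g (with_origin y))%:E)%E.
  by rewrite /mu0 => /negbTE ->.
have core f g f1 C : (forall s, 0 <= s -> 0 <= f s) ->
    (\forall s \near 0^'+, forall Y, rooted_tuples Y -> rho m.+1 (s *: Y) <= C * f s) ->
    (forall Y, rooted_tuples Y -> rho m.+1 (s *: Y) / f s @[s --> 0^'+] --> g Y) ->
    scales_as (rho m.+2) f1 -> (f1 : R -> R^o) =O_ (0^'+) (f : R -> R^o) ->
    mu0 Gamma g = ((m.+1)`!%:R^-1%:E *
      \int[@lebesgue_mx R m d]_y (\1_[set X | geometric_iso Gamma 1 X] (with_origin y) *
        g (with_origin y))%:E)%E ->
    claim f g.
  move=> f0 rho_le rho_g sc1 O1 muE; rewrite /claim muE.
  have [C1 rho'_le] := dominated_scales_as f0 sc1 O1.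
  have [lfin Gl] := cvg_subgraph_count d_gt0 Phi_pp (intensity m) (rho_inv m)
    Gamma_conn r_gt0 r_cvg f0 rho_le rho_g.
  split=> //; apply: (cvg_isolated_count d_gt0 Phi_pp (intensity m.+1) (rho_inv m.+1)
    Gamma_conn r_gt0 r_cvg f0 rho'_le _ Gl).
  by rewrite fin_numM.
split=> [rho00 f f1 g [f0 _ [C rho_le]] [_ rho_g] sc1 O1 _|rho00 crho f1 sc1 O1].
  (* For k = 1 the joint intensity is 1 at the origin. *)
  apply: (core _ _ f1 C) => //; apply: mu0E; apply/eqP => m0.
  move: rho00; subst m => /eqP.
  by rewrite (unit_intensity_density Phi_unit (intensity 0%N) (rho_inv 0%N)) oner_eq0.
have near0 := continuous_at0_scaling crho.
apply: (core _ _ f1 (rho m.+1 0 + 1)) => //.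
- have := near0 _ ltr01; apply: filterS => s near_s Y RY.
  have := near_s _ RY; rewrite mulr1 distrC ltr_norml => /andP[_].
  by rewrite ltrBlDl => /ltW.
- move=> Y RY; apply/cvgrPdist_lt => e e0.
  by have := near0 _ e0; apply: filterS => s near_s; rewrite divr1; exact: near_s.
(* For k = 1 the integral is over a space with one point, of mass 1. *)
have [m0|] := eqVneq m 0%N; last exact: mu0E.
have [_ irr _] := Gamma_conn.
subst m; rewrite /mu0/= (_ : 1`! = 1)%N// invr1 mul1e.
rewrite (unit_intensity_density Phi_unit (intensity 0%N) (rho_inv 0%N)).
rewrite (eq_integral (fun=> 1%:E)); last first.
  move=> y _; rewrite mulr1 indicE mem_set//; exact: geometric_iso_one_vertex.
by rewrite integral_cst// mul1e; have /= -> := @lebesgue_mx0T R d.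
Qed.
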